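(* Let $k \geq 2$ and $n \geq 1$ be integers, let $\rho = (1,k-1,1)$ and $\lambda = n^3=(n,n,n)$. Let $\Phi : \mathrm{PC}^k(n) \rightarrow \mathbb{S}(\lambda,\rho)$ be the bijection obtained from the depth-left first search labelling, let $r: \mathrm{PC}^k(n) \rightarrow \mathrm{PC}^k(n)$ be the rotation operator, and let $f : \mathbb{S}(\lambda,\rho) \rightarrow \mathbb{S}(\lambda,\rho)$ be the set-valued Sch\''utzenberger involution. Then $\Phi \circ r = f \circ \Phi$.
   Context: Tableaux. $(i,j)$ denotes the cell in row $i$ (from the top), column $j$ of the $3\times n$ rectangular array. $\mathbb{S}(n^3,\rho)$ with $\rho=(1,k-1,1)$ is the set of assignments of the integers $1,\dots,(k+1)n$ to the cells of this array so that each cell in rows $1,2,3$ receives precisely $1$, $k-1$, $1$ integers respectively (unordered within the cell), and every integer in cell $(i,j)$ is smaller than every integer in the cells $(i+1,j)$ and $(i,j+1)$. Prographs. Fix two formal operators: a $k$-ary coproduct $\Delta_k$ with $1$ input and $k$ outputs, and a $k$-ary product $\mu_k$ with $k$ inputs and $1$ output (no relations imposed). A $k$-ary prograph is a directed plane graph representing a finite formal composition of copies of $\Delta_k$, $\mu_k$ and identity strands beginning with a single input strand: all edges are directed strictly upward, each $\Delta_k$ is an internal node with $1$ incoming and $k$ outgoing edges, each $\mu_k$ is an internal node with $k$ incoming and $1$ outgoing edge, and graphs are considered up to planar isotopy keeping all edges directed upward. Equivalently: start with one strand, and repeatedly either replace one strand by $k$ consecutive strands (coproduct) or replace $k$ consecutive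 strands by one strand (product), identifying sequences that differ by interchanging consecutive operations acting on disjoint sets of strands (neither using an output of the other). $\mathrm{PC}^k(n)$ is the set of closed $k$-ary prographs (exactly one output strand) with exactly $n$ coproducts and $n$ products. Such a prograph has $(k+1)n+1$ edges. The children of a node are its outgoing edges. Depth-left first search on $G\in \mathrm{PC}^k(n)$: label the initial input edge $0$. Once edges with labels $0,\dots,i$ (with $i<(k+1)n$) are assigned, let $V_i$ be the set of nodes all of whose incoming edges are labelled and at least one of whose outgoing edges is unlabelled; find the highest-labelled edge among those terminating at a node of $V_i$, let $v$ be that node, and give label $i+1$ to the leftmost unlabelled outgoing edge of $v$. Repeat until all edges are labelled. The map $\Phi$: label $G$ by the depth-left first search; put the labels of leftmost coproduct children in the top row, the labels of all other coproduct children in the middle row ($k-1$ per cell), and the labels of product children in the bottom row, each in increasing order from left to right (the label $0$ is ignored). This gives an element $\Phi(G)\in\mathbb{S}(n^3,\rho)$, and $\Phi$ is a bijection. The operator $r$: rotate the prograph by 180 degrees and reverse the orientation of all edges (so that products become coproducts and vice versa). The map $f$: rotate the tableau by 180 degrees and replace each entry $a$ by $(k+1)n-a+1$. *)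

(* Defs.v *)
From HB Require Import structures.
From Stdlib Require Import Relation_Operators.
From mathcomp Require Import all_boot.
From mathcomp Require Import boolp.
From mathcomp Require Import zify.

Set Implicit Arguments.
Unset Strict Implicit.
Unset Printing Implicit Defensive.

Local Open Scope quotient_scope.

(* A prograph is represented by the words, read from the input strand upwards,
   that describe its construction one operation at a time. Two words give the
   same plane graph up to upward planar isotopy exactly when they are related by
   interchanges of consecutive operations acting on disjoint sets of strands. *)
Inductive operator := Coproduct | Product.

Definition is_coproduct (o : operator) : bool :=
  if o is Coproduct then true else false.
Definition operator_of_bool (b : bool) : operator :=
  if b then Coproduct else Product.
Lemma is_coproductK : cancel is_coproduct operator_of_bool.
Proof. by case. Qed.
HB.instance Definition _ := Countable.copy operator (can_type is_coproductK).

Definition arity_in (k : nat) (o : operator) : nat :=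
  if o is Coproduct then 1 else k.
Definition arity_out (k : nat) (o : operator) : nat :=
  if o is Coproduct then k else 1.

(* The layer (l, o, r) applies o with l identity strands to its left and
   r identity strands to its right. *)
Definition layer : Type := (nat * operator * nat)%type.

Fixpoint composes (k s : nat) (w : seq layer) (t : nat) : bool :=
  if w is (l, o, r) :: w' then
    (s == l + arity_in k o + r) && composes k (l + arity_out k o + r) w' t
  else s == t.

(* One output strand, n coproducts and n products *)
Definition closed_word (k n : nat) (w : seq layer) : bool :=
  [&& composes k 1 w 1,
      count (fun x : layer => x.1.2 == Coproduct) w == n &
      count (fun x : layer => x.1.2 == Product) w == n].

(* Only o1-to-the-left-of-o2 is listed, with m strands in between; the other
   case is the converse relation. *)
Inductive interchange (k : nat) : seq layer -> seq layer -> Prop :=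
  Interchange (u v : seq layer) (l m r : nat) (o1 o2 : operator) :
    interchange k
      (u ++ [:: (l, o1, m + arity_in k o2 + r);
                (l + arity_out k o1 + m, o2, r)] ++ v)
      (u ++ [:: (l + arity_in k o1 + m, o2, r);
                (l, o1, m + arity_out k o2 + r)] ++ v).

Definition word (k n : nat) : Type := {w : seq layer | closed_word k n w}.

Definition word_interchange (k n : nat) (w1 w2 : word k n) : Prop :=
  interchange k (val w1) (val w2).

Definition isotopic (k n : nat) : rel (word k n) :=
  fun w1 w2 => `[< clos_refl_sym_trans _ (@word_interchange k n) w1 w2 >].

Lemma isotopic_refl k n : reflexive (@isotopic k n).
Proof. by move=> w; apply/asboolP; apply: rst_refl. Qed.

Lemma isotopic_sym k n : symmetric (@isotopic k n).
Proof. by move=> w1 w2; apply/asboolP/asboolP => h; apply: rst_sym. Qed.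

Lemma isotopic_trans k n : transitive (@isotopic k n).
Proof.
by move=> w2 w1 w3 /asboolP h12 /asboolP h23; apply/asboolP; apply: rst_trans h23.
Qed.

Canonical isotopic_equiv (k n : nat) : equiv_rel (word k n) :=
  EquivRel (@isotopic k n) (@isotopic_refl k n) (@isotopic_sym k n)
    (@isotopic_trans k n).

(* This is PC^k(n). *)
Definition prograph (k n : nat) := {eq_quot (isotopic_equiv k n)}.
HB.instance Definition _ k n := EqQuotient.on (prograph k n).
HB.instance Definition _ k n := Choice.on (prograph k n).

Definition dual (o : operator) : operator :=
  if o is Coproduct then Product else Coproduct.

(* The rotation reads the layers from top to bottom and exchanges the numbers of
   strands on the left and on the right of each operation. *)
Definition rotate_layers (w : seq layer) : seq layer :=
  rev [seq (x.2, dual x.1.2, x.1.1) | x : layer <- w].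

Lemma arity_in_dual k o : arity_in k (dual o) = arity_out k o.
Proof. by case: o. Qed.

Lemma arity_out_dual k o : arity_out k (dual o) = arity_in k o.
Proof. by case: o. Qed.

Lemma composes_rotate k s t w :
  composes k s w t -> composes k t (rotate_layers w) s.
Proof.
elim: w s => [|[[l o] r] w IH] s /=; first by rewrite eq_sym.
case/andP=> /eqP-> /IH; rewrite /rotate_layers map_cons rev_cons -cats1 => h.
set s1 := _ + _ + _ in h.
suff gen u x : composes k u x s1 ->
    composes k u (x ++ [:: (r, dual o, l)]) (l + arity_in k o + r).
  exact: gen h.
elim: x u => [|[[l' o'] r'] x IHx] u /=; last first.
  by case/andP=> -> /IHx.
move=> /eqP->; rewrite /s1 arity_in_dual arity_out_dual.
by apply/andP; split; apply/eqP; lia.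
Qed.

Lemma closed_word_rotate k n w :
  closed_word k n w -> closed_word k n (rotate_layers w).
Proof.
case/and3P=> hw hc hp; apply/and3P; split; first exact: composes_rotate.
  rewrite count_rev count_map -(eqP hp); apply/eqP/eq_count.
  by case=> [[l []] r].
rewrite count_rev count_map -(eqP hc); apply/eqP/eq_count.
by case=> [[l []] r].
Qed.

Definition rotate_word (k n : nat) (w : word k n) : word k n :=
  Sub (rotate_layers (val w)) (closed_word_rotate (valP w)).

Lemma interchange_rotate k w1 w2 :
  interchange k w1 w2 -> interchange k (rotate_layers w1) (rotate_layers w2).
Proof.
case=> u v l m r o1 o2; rewrite /rotate_layers !map_cat !rev_cat /= -!catA.
have := @Interchange k (rotate_layers v) (rotate_layers u) r m l (dual o2) (dual o1).
rewrite !arity_in_dual !arity_out_dual.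
have e x y z : x + y + z = z + y + x by lia.
by rewrite [m + _ + l]e [r + _ + m]e [m + _ + l]e [r + _ + m]e.
Qed.

Lemma isotopic_rotate k n (w1 w2 : word k n) :
  isotopic w1 w2 -> isotopic (rotate_word w1) (rotate_word w2).
Proof.
move=> /asboolP h; apply/asboolP; elim: h => [x y h|x|x y _ h|x y z _ h1 _ h2].
- by apply: rst_step; apply: interchange_rotate.
- exact: rst_refl.
- exact: rst_sym.
- exact: rst_trans h1 h2.
Qed.

Definition rotate (k n : nat) : prograph k n -> prograph k n :=
  lift_op1 (prograph k n) (@rotate_word k n).

Lemma rotate_pi k n : {morph \pi_(prograph k n) : w / rotate_word w >-> rotate w}.
Proof.
move=> w; unlock rotate; apply/eqmodP; apply: isotopic_rotate.
by rewrite -[isotopic _ _]/(isotopic_equiv k n _ _) -eqmodE reprK.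
Qed.

(* (o, inputs, outputs), the edges being listed from left to right *)
Definition node : Type := (operator * seq nat * seq nat)%type.
Definition op_of (x : node) : operator := x.1.1.
Definition ins (x : node) : seq nat := x.1.2.
Definition outs (x : node) : seq nat := x.2.

Fixpoint graph_from (k : nat) (strands : seq nat) (fresh : nat)
    (w : seq layer) : seq node :=
  if w is (l, o, _) :: w' then
    let new := iota fresh (arity_out k o) in
    (o, take (arity_in k o) (drop l strands), new) ::
      graph_from k (take l strands ++ new ++ drop (l + arity_in k o) strands)
        (fresh + arity_out k o) w'
  else [::].

(* Edges are named by natural numbers; the initial input edge is 0. *)
Definition graph (k : nat) (w : seq layer) : seq node := graph_from k [:: 0] 1 w.

(* In the depth-left first search, L lists the labelled edges, the label of an edge being its
   position in L; g is a graph. *)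
Definition active (g : seq node) (L : seq nat) : seq node :=
  [seq x <- g | all [in L] (ins x) && has [predC L] (outs x)].

(* The first element of the comprehension is the active node at which the
   highest-labelled possible edge e terminates. *)
Definition dfs_step (g : seq node) (L : seq nat) : seq nat :=
  if [seq x | e <- rev L, x <- [seq x <- active g L | e \in ins x]] is v :: _
  then rcons L (head 0 [seq e <- outs v | e \notin L])
  else L.

Definition dfs (m : nat) (g : seq node) : seq nat := iter m (dfs_step g) [:: 0].

Definition rho (k : nat) (i : 'I_3) : nat := if i == 1 :> nat then k.-1 else 1.

Definition adjacent (n : nat) (c c' : 'I_3 * 'I_n) : bool :=
  (c'.1 == c.1.+1 :> nat) && (c'.2 == c.2) ||
  (c'.1 == c.1) && (c'.2 == c.2.+1 :> nat).

(* The element a of 'I_(k.+1 * n) stands for the integer a + 1. *)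
Definition filling (k n : nat) : Type :=
  {ffun 'I_3 * 'I_n -> {set 'I_(k.+1 * n)}}.

Definition is_tableau (k n : nat) (T : filling k n) : bool :=
  [&& [forall a, #|[set c | a \in T c]| == 1],
      [forall c, #|T c| == rho k c.1] &
      [forall c, forall c', adjacent c c' ==>
        [forall a in T c, forall b in T c', a < b]]].

(* This is S(n^3, rho). *)
Definition tableau (k n : nat) : Type := {T : filling k n | is_tableau T}.

(* rev_ord maps the integer a + 1 to (k+1)n - (a + 1) + 1. *)
Definition schutz_filling (k n : nat) (T : filling k n) : filling k n :=
  [ffun c => [set rev_ord a | a in T (rev_ord c.1, rev_ord c.2)]].

Lemma rho_rev k (i : 'I_3) : rho k (rev_ord i) = rho k i.
Proof. by case: i => [[|[|[|]]]]. Qed.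

Lemma adjacent_rev n (c c' : 'I_3 * 'I_n) :
  adjacent c c' -> adjacent (rev_ord c'.1, rev_ord c'.2) (rev_ord c.1, rev_ord c.2).
Proof.
case: c c' => [i j] [i' j']; rewrite /adjacent /= -!val_eqE /=.
have := ltn_ord i; have := ltn_ord i'; have := ltn_ord j; have := ltn_ord j'.
lia.
Qed.

Lemma is_tableau_schutz k n (T : filling k n) :
  is_tableau T -> is_tableau (schutz_filling T).
Proof.
case/and3P=> /forallP hcov /forallP hcard /forallP hadj.
have inE' a c : (a \in schutz_filling T c) =
                (rev_ord a \in T (rev_ord c.1, rev_ord c.2)).
  rewrite ffunE; apply/imsetP/idP => [[b hb ->]|h]; first by rewrite rev_ordK.
  by exists (rev_ord a); rewrite ?rev_ordK.
apply/and3P; split; apply/forallP.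
- move=> a; apply/eqP; apply: etrans (eqP (hcov (rev_ord a))).
  pose h (c : 'I_3 * 'I_n) := (rev_ord c.1, rev_ord c.2).
  have hK : involutive h by case=> i j; rewrite /h !rev_ordK.
  rewrite -(card_imset [set c | rev_ord a \in T c] (inv_inj hK)).
  apply: eq_card => c; rewrite inE inE'; apply/idP/imsetP => [hc|[c' hc ->]].
    by exists (h c); rewrite ?inE ?hK.
  by move: hc; rewrite inE -{1}[c']hK.
- by move=> c; rewrite ffunE (card_imset _ rev_ord_inj) (eqP (hcard _)) rho_rev.
- move=> c; apply/forallP=> c'; apply/implyP=> /adjacent_rev hcc.
  apply/forall_inP=> a; rewrite inE' => ha; apply/forall_inP=> b; rewrite inE' => hb.
  have /forallP/(_ (rev_ord c.1, rev_ord c.2))/implyP/(_ hcc) := hadj (rev_ord c'.1, rev_ord c'.2).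
  move=> /forall_inP/(_ _ hb)/forall_inP/(_ _ ha) /=.
  by have := ltn_ord a; have := ltn_ord b; lia.
Qed.

Definition schutzenberger (k n : nat) (T : tableau k n) : tableau k n :=
  Sub (schutz_filling (val T)) (is_tableau_schutz (valP T)).

Definition row_edges (g : seq node) (i : nat) : seq nat :=
  match i with
  | 0 => [seq head 0 (outs x) | x <- g & op_of x == Coproduct]
  | 1 => flatten [seq behead (outs x) | x <- g & op_of x == Coproduct]
  | _ => flatten [seq outs x | x <- g & op_of x == Product]
  end.

Definition row_labels (m : nat) (g : seq node) (i : nat) : seq nat :=
  sort leq [seq index e (dfs m g) | e <- row_edges g i].

(* Cell c receives the c.2-th block of rho k c.1 consecutive labels of row c.1. *)
Definition Phi_filling (k n : nat) (w : seq layer) : filling k n :=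
  [ffun c : 'I_3 * 'I_n =>
    [set a : 'I_(k.+1 * n) | a.+1 \in
      take (rho k c.1) (drop (c.2 * rho k c.1)
        (row_labels (k.+1 * n) (graph k w) c.1))]].

Definition well_formed (k m : nat) (g : seq node) : Prop :=
  [/\ flatten (map outs g) = iota 1 m,
      uniq (flatten (map ins g)),
      forall x, x \in g -> size (ins x) = arity_in k (op_of x) /\
                           size (outs x) = arity_out k (op_of x) &
      forall L : seq nat, 0 \in L -> active g L = [::] ->
        {subset flatten (map outs g) <= L}].

Lemma graph_from_outs k S fr w :
  exists m, [/\ flatten (map outs (graph_from k S fr w)) = iota fr m &
    m = k * count (fun x : layer => x.1.2 == Coproduct) w +
        count (fun x : layer => x.1.2 == Product) w].
Proof.
elim: w S fr => [|[[l o] r] w IH] S fr /=; first by exists 0; rewrite muln0.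
have [m [-> ->]] := IH (take l S ++ iota fr (arity_out k o) ++
  drop (l + arity_in k o) S) (fr + arity_out k o).
rewrite -iotaD; eexists; split; first by [].
by case: o => /=; rewrite ?add0n ?add1n; lia.
Qed.

Lemma perm_take_drop (S : seq nat) l a :
  perm_eq (take a (drop l S) ++ take l S ++ drop (l + a) S) S.
Proof.
rewrite perm_catCA addnC -drop_drop cat_take_drop.
by rewrite cat_take_drop.
Qed.

Lemma graph_from_ins k S fr w : uniq S -> all (fun e => e < fr) S ->
  uniq (flatten (map ins (graph_from k S fr w))) /\
  {in flatten (map ins (graph_from k S fr w)), forall e, e \in S \/ fr <= e}.
Proof.
elim: w S fr => [|[[l o] r] w IH] S fr //= uS ltS.
set a := arity_in k o; set b := arity_out k o.
set S' := take l S ++ iota fr b ++ drop (l + a) S.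
rewrite -/(ins (o, _, _)) {1 3}/ins /=.
have hp := perm_take_drop S l a.
have uS2 := uS; rewrite -(perm_uniq hp) cat_uniq in uS2.
case/and3P: uS2 => uI hI uR.
have memS e : e \in S = (e \in take a (drop l S)) || (e \in take l S ++ drop (l + a) S).
  by rewrite -mem_cat (perm_mem hp).
have memS' e : e \in S' = (e \in take l S ++ drop (l + a) S) || (fr <= e < fr + b).
  by rewrite /S' !mem_cat mem_iota orbAC -orbA.
have uS' : uniq S'.
  rewrite /S' uniq_catCA cat_uniq iota_uniq uR andbT /=.
  apply/hasPn => e he; rewrite mem_iota.
  have : e \in S by rewrite memS he orbT.
  by move=> /(allP ltS); lia.
have ltS' : all (fun e => e < fr + b) S'.
  apply/allP => e; rewrite memS' => /orP[he|]; last by lia.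
  have : e \in S by rewrite memS he orbT.
  by move=> /(allP ltS); lia.
have [u h] := IH _ _ uS' ltS'.
rewrite cat_uniq uI u andbT /=; split.
  apply/hasPn => e /h he; apply/negP => heI.
  have heS : e \in S by rewrite memS heI.
  have := allP ltS _ heS; case: he => [|]; last by lia.
  rewrite memS' => /orP[he|]; last by lia.
  by move/hasPn/(_ _ he)/negP: hI; rewrite heI.
move=> e; rewrite mem_cat => /orP[he|/h [|]]; last by lia.
  by left; rewrite memS he.
rewrite memS' => /orP[he|]; last by lia.
by left; rewrite memS he orbT.
Qed.

Lemma graph_from_size k S fr w t : composes k (size S) w t ->
  forall x, x \in graph_from k S fr w -> size (ins x) = arity_in k (op_of x) /\
                           size (outs x) = arity_out k (op_of x).
Proof.
elim: w S fr => [|[[l o] r] w IH] S fr //= /andP[/eqP hS hw] x.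
rewrite in_cons => /orP[/eqP->|]; rewrite /ins /outs /op_of /=.
  rewrite size_iota size_takel // size_drop; lia.
apply: IH; rewrite !size_cat size_iota size_drop size_takel ?hS; last by lia.
by rewrite (_ : l + _ = l + arity_out k o + r) //; lia.
Qed.

Lemma graph_from_progress k S fr w (L : seq nat) : {subset S <= L} ->
  active (graph_from k S fr w) L = [::] ->
  {subset flatten (map outs (graph_from k S fr w)) <= L}.
Proof.
elim: w S fr => [|[[l o] r] w IH] S fr //= SL.
rewrite /active /= /ins /outs /=.
have -> : all [in L] (take (arity_in k o) (drop l S)).
  by apply/allP => e /mem_take /mem_drop /SL.
rewrite /=; case: ifP => // /hasPn hb hact e; rewrite mem_cat.
have hnew e' : e' \in iota fr (arity_out k o) -> e' \in L by move/hb; rewrite /= negbK.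
case/orP; first exact: hnew.
apply: IH hact e => e; rewrite !mem_cat => /or3P[/mem_take|/hnew|/mem_drop] //; exact: SL.
Qed.

Lemma graph_well_formed k n w :
  closed_word k n w -> well_formed k (k.+1 * n) (graph k w).
Proof.
case/and3P=> hw /eqP hc /eqP hp; split.
- have [m [h hm]] := graph_from_outs k [:: 0] 1 w.
  by rewrite /graph h hm hc hp mulSn addnC.
- by have [] := @graph_from_ins k [:: 0] 1 w isT isT.
- exact: (@graph_from_size k [:: 0] 1 w 1).
- move=> L L0 hL; apply: graph_from_progress hL => e; by rewrite inE => /eqP->.
Qed.

Definition dfs_invariant (k m : nat) (g : seq node) (L : seq nat) : Prop :=
  [/\ exists L', L = 0 :: L',
      uniq L /\ {subset L <= iota 0 m.+1},
      {in g, forall x, has [in L] (outs x) -> all [in L] (ins x)},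
      {in g, forall x, op_of x = Coproduct -> has [in L] (outs x) ->
         head 0 (outs x) \in L} &
      k.-1 * count [in L] (row_edges g 2) <= count [in L] (row_edges g 1)].

Lemma count_mem_subset (T : eqType) (P : pred T) (s1 s2 : seq T) :
  uniq s1 -> {subset s1 <= s2} -> count P s1 <= count P s2.
Proof.
move=> u h; rewrite -!size_filter; apply: uniq_leq_size; first exact: filter_uniq.
by move=> x; rewrite !mem_filter => /andP[-> /h].
Qed.

Lemma perm_rows k m g : 0 < k -> well_formed k m g ->
  perm_eq (row_edges g 0 ++ row_edges g 1 ++ row_edges g 2) (iota 1 m).
Proof.
move=> k0 [<- _ hs _].
have {}hs : {in g, forall x, op_of x = Coproduct -> outs x != [::]}.
  by move=> x /hs[_ h] ho; rewrite -size_eq0 h ho -lt0n.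
elim: g hs => [|x g IH] //= hs.
have {}IH := IH (fun y hy => hs y (mem_behead (s := x :: g) hy)).
have hx := hs x (mem_head _ _); rewrite perm_sym.
have {}IH s : perm_eq (s ++ flatten (map outs g))
    (s ++ row_edges g 0 ++ row_edges g 1 ++ row_edges g 2).
  by rewrite perm_cat2l perm_sym.
apply: perm_trans (IH _) _; rewrite /row_edges /=.
case: (op_of x) hx => [/(_ erefl)|_] /=; last by rewrite perm_catCA perm_cat2l perm_catCA.
by case: (outs x) => //= e s _; rewrite perm_cons -!catA perm_catCA.
Qed.

Lemma count_rows k m g P : 0 < k -> well_formed k m g ->
  count P (row_edges g 0) + count P (row_edges g 1) + count P (row_edges g 2)
  = count P (iota 1 m).
Proof.
by move=> k0 hg; rewrite -(permP (perm_rows k0 hg)) !count_cat addnA.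
Qed.

Lemma count_labelled m (L L' : seq nat) : L = 0 :: L' -> uniq L ->
  {subset L <= iota 0 m.+1} -> (count [in L] (iota 1 m)).+1 = size L.
Proof.
move=> eL u h; have -> : (count [in L] (iota 1 m)).+1 = count [in L] (iota 0 m.+1).
  by rewrite /= (_ : 0 \in L) // eL mem_head.
rewrite -size_filter; apply/perm_size/uniq_perm => //.
  exact/filter_uniq/iota_uniq.
move=> e; rewrite mem_filter /=; case he: (e \in L) => //=; exact: h.
Qed.

Lemma invariant_row1 k m g L : well_formed k m g -> dfs_invariant k m g L ->
  count [in L] (row_edges g 1) <= k.-1 * count [in L] (row_edges g 0).
Proof.
move=> [_ _ hs _] [_ _ _ hL _]; move: hs hL; rewrite /row_edges.
elim: g => [|x g IH] // hs hL /=.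
have {}IH := IH (fun y hy => hs y (mem_behead (s := x :: g) hy))
                (fun y hy => hL y (mem_behead (s := x :: g) hy)).
have [_] := hs x (mem_head _ _); have := hL x (mem_head _ _).
case: (op_of x) => //= /(_ erefl) h hsz.
rewrite count_cat mulnDr; apply: leq_add => //; move: h hsz.
case: (outs x) => [|e s] //= h; case: k {IH hs} => //= k [<-].
case he : (e \in L) h; first by rewrite muln1 => _; exact: count_size.
move=> h; rewrite muln0 leqn0 -leqn0 leqNgt -has_count; apply/negP => hh.
by have := h hh; rewrite /=.
Qed.

Lemma filter_flatten_subseq (T S : eqType) (f : T -> seq S) P s :
  subseq (flatten (map f (filter P s))) (flatten (map f s)).
Proof.
elim: s => //= x s IH; case: (P x) => /=; first exact: cat_subseq.
exact: subseq_trans IH (suffix_subseq _ _).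
Qed.

Lemma row2_bound k m g (L L1 : seq nat) : 0 < k -> well_formed k m g -> 
  {in g, forall x, has [in L] (outs x) -> {subset ins x <= L1}} ->
  count [in L] (row_edges g 0) + k * count [in L] (row_edges g 2) <= size L1.
Proof.
move=> k0 [_ hu hs _] hL.
pose W := [seq x <- g | has [in L] (outs x)].
have : size (flatten (map ins W)) <= size L1.
  apply: uniq_leq_size; first exact: subseq_uniq (filter_flatten_subseq _ _ _) hu.
  by move=> e /flattenP[s /mapP[x]]; rewrite mem_filter => /andP[hx xg] -> /(hL x xg hx).
apply: leq_trans; rewrite /W {W hu hL} /row_edges.
elim: g hs => [|x g IH] hs /=; first by rewrite muln0.
have {}IH := IH (fun y hy => hs y (mem_behead (s := x :: g) hy)).
have [hi ho] := hs x (mem_head _ _).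
case: (op_of x) hi ho => /= hi ho.
  case hx: (has _ _) => /=.
    by rewrite size_cat hi -addnA; apply: leq_add IH; case: (_ \in L).
  case: (outs x) ho hx => [|e s] /=; first lia.
  by case: (e \in L).
rewrite count_cat; case: (outs x) ho => [|e [|]] //= _; rewrite orbF addn0.
case: (e \in L) => //=.
by rewrite size_cat hi mulnDr muln1 addnCA; apply: leq_add IH.
Qed.

Lemma head_filter_in (s : seq nat) (P : pred nat) : has P s ->
  head 0 [seq e <- s | P e] \in [seq e <- s | P e].
Proof. by rewrite has_filter; case: filter => //= e s' _; rewrite mem_head. Qed.

Lemma dfs_stepP k m g L : 0 < k -> well_formed k m g -> dfs_invariant k m g L ->
  size L <= m ->
  exists v e, [/\ v \in g, {subset ins v <= L}, e \in outs v, e \notin L &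
    dfs_step g L = rcons L e /\ (e = head 0 (outs v) \/ head 0 (outs v) \in L)].
Proof.
move=> k0 [hout _ hs hprog] [[L' eL] [uL LE] _ _ _] szL; rewrite /dfs_step.
case hc: [seq x | e <- rev L, x <- [seq x <- active g L | e \in ins x]] => [|v c].
  have L0 : 0 \in L by rewrite eL mem_head.
  have hact : active g L = [::].
    case ha: (active g L) => [|x s] //.
    have : x \in active g L by rewrite ha mem_head.
    move=> hx; have := hx; rewrite mem_filter => /andP[/andP[/allP hxi _] xg].
    have [] := hs x xg; case hi: (ins x) => [|e t].
      by case: (op_of x) => /=; lia.
    move=> _ _; suff : x \in [::] by []. rewrite -hc.
    apply/allpairsPdep; exists e, x; split=> //.
      by rewrite mem_rev; apply: hxi; rewrite hi mem_head.
    by rewrite mem_filter hi mem_head hx.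
  have := hprog L L0 hact; rewrite hout => hsub.
  have := uniq_leq_size (iota_uniq 0 m.+1) (s2 := L); rewrite size_iota => h.
  have : m < size L; last by lia.
  by apply: h => e; rewrite /= in_cons => /orP[/eqP->|/hsub].
have : v \in [seq x | e <- rev L, x <- [seq x <- active g L | e \in ins x]].
  by rewrite hc mem_head.
case/allpairsPdep => e0 [x [_ hx ev]]; subst x; move: hx.
rewrite mem_filter => /andP[_]; rewrite mem_filter => /andP[/andP[/allP hvi hvo] vg].
have := head_filter_in hvo; rewrite mem_filter => /andP[he1 he2].
exists v, (head 0 [seq e <- outs v | e \notin L]); split=> //; split=> //.
case: (outs v) => [|e s] /=; first by left.
by case he: (e \in L) => /=; [right | left].
Qed.

Lemma flatten_map_inj (T S : eqType) (f : T -> seq S) s x y e :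
  uniq (flatten (map f s)) -> x \in s -> y \in s -> e \in f x -> e \in f y ->
  x = y.
Proof.
elim: s => //= z s IH; rewrite cat_uniq => /and3P[_ /hasPn hd u].
have out t : t \in s -> e \in f t -> e \notin f z.
  by move=> ts et; apply: hd; apply/flatten_mapP; exists t.
rewrite !in_cons => /orP[/eqP->|xs] /orP[/eqP->|ys] ex ey //.
- by case/negP: (out y ys ey).
- by case/negP: (out x xs ex).
- exact: IH.
Qed.

Lemma dfs_step_invariant k m g L : 0 < k -> well_formed k m g ->
  dfs_invariant k m g L -> size L <= m -> dfs_invariant k m g (dfs_step g L).
Proof.
move=> k0 hg hL szL; have [v [e [vg vL ev eL [-> hhead]]]] := dfs_stepP k0 hg hL szL.
have [hout hu hs _] := hg.
have [[L' eqL] [uL LE] hI hH hB] := hL.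
have uL2 : uniq (rcons L e) by rewrite rcons_uniq eL.
have LE2 : {subset rcons L e <= iota 0 m.+1}.
  move=> e'; rewrite mem_rcons in_cons => /orP[/eqP->|/LE //].
  have : e \in flatten (map outs g) by apply/flatten_mapP; exists v.
  by rewrite hout /= in_cons => ->; rewrite orbT.
have uouts : uniq (flatten (map outs g)) by rewrite hout iota_uniq.
have labelled x : x \in g -> has [in rcons L e] (outs x) -> has [in L] (outs x) \/ x = v.
  move=> xg /hasP[e' he' /=]; rewrite mem_rcons in_cons => /orP[/eqP ee|h].
    by right; apply: (flatten_map_inj uouts xg vg) ev; rewrite -ee.
  by left; apply/hasP; exists e'.
have hI2 x : x \in g -> has [in rcons L e] (outs x) -> {subset ins x <= L}.
  by move=> xg /(labelled x xg) [/(hI x xg)/allP //|->].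
have eL2 : rcons L e = 0 :: rcons L' e by rewrite eqL.
split=> //.
- by exists (rcons L' e).
- move=> x xg /(hI2 x xg) h; apply/allP => e' /h /=.
  by rewrite mem_rcons in_cons orbC => ->.
- move=> x xg ho /(labelled x xg) [/(hH x xg ho)|->]; rewrite mem_rcons in_cons.
    by move=> ->; rewrite orbT.
  by case: hhead => ->; rewrite ?eqxx ?orbT.
have := row2_bound k0 hg hI2; have := count_labelled eL2 uL2 LE2.
rewrite size_rcons => -[<-]; rewrite -(count_rows _ k0 hg).
by case: k k0 {hg hL hs hB} => //= k _; rewrite mulSn; lia.
Qed.

Lemma dfs_invariantP k m g t : 0 < k -> well_formed k m g -> t <= m ->
  dfs_invariant k m g (dfs t g) /\ size (dfs t g) = t.+1.
Proof.
move=> k0 hg; elim: t => [|t IH] ht.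
  have h0 x : x \in g -> has [in [:: 0]] (outs x) = false.
    move=> xg; apply/negP => /hasP[e ex]; rewrite /= inE => /eqP e0.
    have : e \in flatten (map outs g) by apply/flatten_mapP; exists x.
    by have [-> _ _ _] := hg; rewrite mem_iota e0.
  split=> //; split.
  - by exists [::].
  - by split=> // e; rewrite inE => /eqP->.
  - by move=> x /h0->.
  - by move=> x /h0->.
  suff -> : count [in [:: 0]] (row_edges g 2) = 0 by rewrite muln0.
  apply/eqP; rewrite -leqn0 leqNgt -has_count; apply/hasPn => e /flatten_mapP[x].
  by rewrite mem_filter => /andP[_ /h0/hasPn h] /h.
have [inv sz] := IH (ltnW ht); have szm : size (dfs t g) <= m by rewrite sz.
split; first exact: dfs_step_invariant.
by have [v [e [_ _ _ _ [h _]]]] := dfs_stepP k0 hg inv szm; rewrite /= h size_rcons sz.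
Qed.

Lemma dfs_take k m g t : 0 < k -> well_formed k m g -> t <= m ->
  take t.+1 (dfs m g) = dfs t g.
Proof.
move=> k0 hg ht; suff gen d : t + d <= m -> take t.+1 (dfs (t + d) g) = dfs t g.
  by have := gen (m - t); rewrite subnKC // => ->.
elim: d => [|d IH] hd.
  by rewrite addn0 take_oversize // (dfs_invariantP k0 hg ht).2.
have htd : t + d <= m by lia.
have [inv sz] := dfs_invariantP k0 hg htd.
have szm : size (dfs (t + d) g) <= m by rewrite sz; lia.
have [v [e [_ _ _ _ [h _]]]] := dfs_stepP k0 hg inv szm.
by rewrite addnS /= h -cats1 takel_cat ?IH // sz; lia.
Qed.

Lemma mem_block (s : seq nat) d r b : uniq s ->
  (b \in take r (drop d s)) = (b \in s) && (d <= index b s < d + r).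
Proof.
move=> us; apply/(nthP 0)/andP => [[q]|[bs hb]].
  rewrite size_take_min size_drop leq_min => /andP[qr qs] <-.
  rewrite nth_take // nth_drop mem_nth ?index_uniq //; lia.
have := bs; rewrite -index_mem => hlt; exists (index b s - d).
  by rewrite size_take_min size_drop; lia.
by rewrite nth_take ?nth_drop ?subnKC ?nth_index //; lia.
Qed.

Lemma index_lt_count (s : seq nat) a t : sorted ltn s -> a \in s ->
  index a s < count (leq^~ t) s -> a <= t.
Proof.
move=> hs ha; have hs' : sorted leq s by apply: sub_sorted hs => x y /ltnW.
apply: contraTT; rewrite -ltnNge -leqNgt => ta.
rewrite -size_filter -[index a s](@size_takel _ _ s) ?index_size //.
apply: uniq_leq_size; first exact/filter_uniq/(sorted_uniq ltn_trans ltnn).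
move=> b; rewrite mem_filter => /andP[bt bs]; rewrite in_take // ltnNge.
apply/negP => h; have : a <= b.
  by apply: (sorted_leq_index leq_trans leqnn hs' _ _ ha bs h).
lia.
Qed.

Lemma index_count (s : seq nat) b : sorted ltn s -> b \in s ->
  index b s < count (leq^~ b) s.
Proof.
move=> hs hb; have hs' : sorted leq s by apply: sub_sorted hs => x y /ltnW.
have hlt := hb; rewrite -index_mem in hlt.
rewrite -size_filter -[(index b s).+1](@size_takel _ _ s) //.
apply: uniq_leq_size; first exact/take_uniq/(sorted_uniq ltn_trans ltnn).
move=> a ha; have as_ := mem_take ha; rewrite mem_filter as_ andbT.
move: ha; rewrite in_take // ltnS => h.
by apply: (sorted_leq_index leq_trans leqnn hs' _ _ as_ hb h).
Qed.

Lemma dfs_perm k m g : 0 < k -> well_formed k m g ->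
  exists2 L', dfs m g = 0 :: L' & perm_eq L' (iota 1 m) /\ uniq (0 :: L').
Proof.
move=> k0 hg; have [[[L' eL] [uL LE] _ _ _] sz] := dfs_invariantP k0 hg (leqnn m).
exists L' => //; rewrite -eL; split=> //.
rewrite -(perm_cons 0) -eL; apply: uniq_perm (uL) (iota_uniq 0 m.+1) _.
by have [] := uniq_min_size uL LE; rewrite ?sz ?size_iota.
Qed.

Lemma perm_row_labels k m g : 0 < k -> well_formed k m g ->
  perm_eq (row_labels m g 0 ++ row_labels m g 1 ++ row_labels m g 2) (iota 1 m).
Proof.
move=> k0 hg; have [L' eL [pL uL]] := dfs_perm k0 hg.
have h i : perm_eq (row_labels m g i) [seq index e (dfs m g) | e <- row_edges g i].
  by rewrite /row_labels perm_sort.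
apply: perm_trans (perm_cat (h 0) (perm_cat (h 1) (h 2))) _.
rewrite -!map_cat; apply: perm_trans (perm_map _ (perm_rows k0 hg)) _.
apply: perm_trans (perm_map (index^~ (dfs m g)) _) _.
  by rewrite perm_sym; exact: pL.
have szL : size L' = m by rewrite (perm_size pL) size_iota.
suff -> : [seq index e (dfs m g) | e <- L'] = iota 1 m by [].
apply: (@eq_from_nth _ 0) => [|q]; rewrite size_map ?size_iota // => hq.
rewrite (nth_map 0) // nth_iota -?szL // szL eL add1n.
by rewrite -[nth 0 L' q]/(nth 0 (0 :: L') q.+1) index_uniq.
Qed.

Lemma row_labels_sorted k m g i : 0 < k -> well_formed k m g -> i < 3 ->
  sorted ltn (row_labels m g i).
Proof.
move=> k0 hg hi; rewrite ltn_sorted_uniq_leq sort_sorted ?andbT; last exact: leq_total.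
have := perm_uniq (perm_row_labels k0 hg); rewrite iota_uniq !cat_uniq.
by case: i hi => [|[|[|]]] // _ => /and3P[? ? /and3P[]].
Qed.

Lemma count_row_labels k m g i t : 0 < k -> well_formed k m g -> i < 3 -> t <= m ->
  count (leq^~ t) (row_labels m g i) = count [in dfs t g] (row_edges g i).
Proof.
move=> k0 hg hi ht; rewrite /row_labels (permP (permEl (perm_sort _ _))) count_map.
apply: eq_in_count => e he /=; rewrite -(dfs_take k0 hg ht) in_take ?ltnS //.
have [L' eL [pL _]] := dfs_perm k0 hg; rewrite eL in_cons (perm_mem pL).
rewrite -(perm_mem (perm_rows k0 hg)) !mem_cat orbC.
by case: i hi he => [|[|[|]]] // _ ->; rewrite ?orbT.
Qed.

Lemma row_labels_le k m g t : 0 < k -> well_formed k m g -> t <= m ->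
  count (leq^~ t) (row_labels m g 1) <= k.-1 * count (leq^~ t) (row_labels m g 0) /\
  k.-1 * count (leq^~ t) (row_labels m g 2) <= count (leq^~ t) (row_labels m g 1).
Proof.
move=> k0 hg ht; rewrite !(count_row_labels k0 hg) //.
have [inv _] := dfs_invariantP k0 hg ht; split; last by have [] := inv.
exact: invariant_row1 hg inv.
Qed.

Lemma size_row_labels k n w (i : 'I_3) : 0 < k -> closed_word k n w ->
  size (row_labels (k.+1 * n) (graph k w) i) = n * rho k i.
Proof.
move=> k0 hw; have hg := graph_well_formed hw; have [_ _ hs _] := hg.
have /and3P[_ /eqP hc /eqP hp] := hw.
have hops o : count (fun x => op_of x == o) (graph k w) =
    count (fun x : layer => x.1.2 == o) w.
  rewrite /graph; elim: w [:: 0] 1 {hw hg hs hc hp} => [|[[l o'] r] w IH] S fr //=.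
  by rewrite IH.
rewrite size_sort size_map.
have hC : size (row_edges (graph k w) 0) = n by rewrite size_map size_filter hops hc.
have hM g : (forall x, x \in g -> size (ins x) = arity_in k (op_of x) /\
                           size (outs x) = arity_out k (op_of x)) ->
  size (row_edges g 1) = count (fun x => op_of x == Coproduct) g * k.-1 /\
  size (row_edges g 2) = count (fun x => op_of x == Product) g.
  elim: g => [|x g IH] // hx.
  have [h1 h2] := IH (fun y hy => hx y (mem_behead (s := x :: g) hy)).
  have [_] := hx x (mem_head _ _); move: h1 h2; rewrite /row_edges /=.
  by case: (op_of x) => /= h1 h2 h; rewrite size_cat ?size_behead h ?h1 ?h2.
have [h1 h2] := hM _ hs.
case: i => [[|[|[|]]]] // hi; rewrite /rho /= ?muln1.
- exact: hC.
- by rewrite h1 hops hc.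
- by rewrite h2 hops hp.
Qed.

Lemma card_succ_set m (s : seq nat) : uniq s -> {subset s <= iota 1 m} ->
  #|[set a : 'I_m | a.+1 \in s]| = size s.
Proof.
move=> us hs; rewrite cardE -(size_map (fun a : 'I_m => a.+1)).
apply/perm_size/uniq_perm => //.
  by rewrite map_inj_uniq ?enum_uniq // => a b [] /val_inj.
move=> b; apply/mapP/idP => [[a]|hb]; first by rewrite mem_enum inE => ? ->.
have := hs b hb; rewrite mem_iota => hb'; have hlt : b.-1 < m by lia.
by exists (Ordinal hlt); rewrite ?mem_enum ?inE /= prednK //; lia.
Qed.

Lemma is_tableau_Phi k n w : 1 < k -> closed_word k n w ->
  is_tableau (Phi_filling k n w).
Proof.
move=> k1 hw; have k0 := ltnW k1; have hg := graph_well_formed hw.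
set m := k.+1 * n; pose R i := row_labels m (graph k w) i.
have hp : perm_eq (R 0 ++ R 1 ++ R 2) (iota 1 m) := perm_row_labels k0 hg.
have hsz (i : 'I_3) : size (R i) = n * rho k i := size_row_labels i k0 hw.
have hst (i : 'I_3) : sorted ltn (R i) := row_labels_sorted k0 hg (ltn_ord i).
have hu (i : 'I_3) : uniq (R i) := sorted_uniq ltn_trans ltnn (hst i).
have rho0 i : 0 < rho k i by rewrite /rho; case: ifP => //; lia.
have hsub (i : 'I_3) : {subset R i <= iota 1 m}.
  move=> a; rewrite -(perm_mem hp) !mem_cat.
  by case: i => [[|[|[|]]]] // hi ->; rewrite ?orbT.
have hex a : a \in iota 1 m -> exists i : 'I_3, a \in R i.
  rewrite -(perm_mem hp) !mem_cat => /or3P[h|h|h].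
  - by exists (@Ordinal 3 0 isT).
  - by exists (@Ordinal 3 1 isT).
  - by exists (@Ordinal 3 2 isT).
have hdis (i i' : 'I_3) a : a \in R i -> a \in R i' -> i = i'.
  have := perm_uniq hp; rewrite iota_uniq !cat_uniq has_cat negb_or.
  case/and5P=> _ /andP[/hasPn h01 /hasPn h02] _ /hasPn h12 _ h h'; apply: val_inj.
  case: i i' h h' => [[|[|[|]]]] // hi [[|[|[|]]]] //= hi' h h'.
  - by case/negP: (h01 a h').
  - by case/negP: (h02 a h').
  - by case/negP: (h01 a h).
  - by case/negP: (h12 a h').
  - by case/negP: (h02 a h).
  - by case/negP: (h12 a h).
have memE (a : 'I_m) (c : 'I_3 * 'I_n) : (a \in Phi_filling k n w c) =
    (a.+1 \in R c.1) && (index a.+1 (R c.1) %/ rho k c.1 == c.2).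
  rewrite ffunE inE mem_block ?hu //; congr (_ && _).
  by rewrite eqn_leq leq_divRL // andbC -[_ %/ _ <= _]ltnS ltn_divLR // (mulSnr c.2).
apply/and3P; split; apply/forallP.
- move=> a; have /hex[i hi] : a.+1 \in iota 1 m by rewrite mem_iota; have := ltn_ord a; lia.
  have hj : index a.+1 (R i) %/ rho k i < n by rewrite ltn_divLR // -hsz index_mem.
  apply/cards1P; exists (i, Ordinal hj); apply/setP => -[i' j].
  rewrite !inE memE /= xpair_eqE; apply/andP/andP => [[h /eqP hd]|[/eqP-> /eqP->] //].
  by have e := hdis _ _ _ hi h; subst i'; rewrite eqxx -val_eqE /= hd.
- move=> [i j]; rewrite ffunE card_succ_set /=.
  + rewrite size_takel // size_drop hsz -mulnBl leq_pmull //; have := ltn_ord j; lia.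
  + exact/take_uniq/drop_uniq/hu.
  + by move=> a /mem_take/mem_drop/hsub.
- move=> [i j]; apply/forallP=> -[i' j']; apply/implyP=> hadj.
  apply/forall_inP=> a; rewrite memE /= => /andP[ha /eqP qa].
  apply/forall_inP=> b; rewrite memE /= => /andP[hb /eqP qb].
  case/orP: hadj => /= /andP[].
    move=> hii /eqP ej; subst j'; have bm : b.+1 <= m := ltn_ord b.
    have [le1 le2] := row_labels_le k0 hg bm.
    have hcb := index_count (hst i') hb.
    suff hab : a.+1 <= b.+1.
      rewrite ltnNge leq_eqVlt negb_or -leqNgt; apply/andP; split; last by [].
      apply/eqP => /val_inj eab; subst b; have e := hdis _ _ _ ha hb.
      by move: hii; rewrite e; lia.
    apply: (index_lt_count (hst i) ha).
    have la : index a.+1 (R i) < j.+1 * rho k i by rewrite -ltn_divLR // qa.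
    have lb : j * rho k i' <= index b.+1 (R i') by rewrite -leq_divRL // qb.
    case: i i' hii la lb hcb {ha hb qa qb} => [[|[|[|]]]] // hi [[|[|[|]]]] //= hi' _;
      rewrite /rho /= ?muln1 => la lb hcb.
    - have : j * k.-1 < k.-1 * count (leq^~ b.+1) (R 0).
        by apply: leq_trans le1; apply: leq_ltn_trans lb _.
      by rewrite mulnC ltn_pmul2l; [exact: leq_trans la | lia].
    - apply: leq_trans le2; apply: leq_trans la _; rewrite mulnC leq_mul2l.
      by apply/orP; right; apply: leq_ltn_trans lb hcb.
  move=> /eqP ei /eqP ej; subst i'.
  have : a.+1 < b.+1; last by [].
  apply: (sorted_ltn_index ltn_trans (hst i) _ _ ha hb).
  rewrite ltnNge; apply/negP => /(leq_div2r (rho k i)); rewrite qa qb ej; lia.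
Qed.

Definition Phi_word (k n : nat) (hk : 1 < k) (w : word k n) : tableau k n :=
  Sub (Phi_filling k n (val w)) (is_tableau_Phi hk (valP w)).

Definition Phi (k n : nat) (hk : 1 < k) : prograph k n -> tableau k n :=
  lift_fun1 (prograph k n) (@Phi_word k n hk).

Definition rename (s : nat -> nat) (x : node) : node :=
  (op_of x, map s (ins x), map s (outs x)).

Lemma eq_dfs_step g g' (L L' : seq nat) (s : nat -> nat) : s 0 = 0 -> injective s ->
  g' = map (rename s) g -> L' = map s L -> dfs_step g' L' = map s (dfs_step g L).
Proof.
move=> s0 sI -> ->; rewrite /dfs_step.
have hact : active (map (rename s) g) (map s L) = map (rename s) (active g L).
  rewrite /active filter_map; congr map; apply: eq_filter => x /=.
  rewrite all_map has_map; congr (_ && _); first by apply: eq_all => e /=; rewrite mem_map.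
  by apply: eq_has => e /=; rewrite mem_map.
rewrite hact -map_rev.
have -> : [seq x | e <- map s (rev L),
      x <- [seq x <- map (rename s) (active g L) | e \in ins x]] =
    map (rename s) [seq x | e <- rev L, x <- [seq x <- active g L | e \in ins x]].
  elim: (rev L) => //= e l IH; rewrite IH map_cat; congr (_ ++ _).
  rewrite !map_id filter_map; congr map; apply: eq_filter => x /=; by rewrite mem_map.
case: [seq x | e <- rev L, x <- _] => //= v _; rewrite map_rcons; congr rcons.
rewrite filter_map (eq_filter (a2 := fun e => e \notin L)) => [|e /=]; last by rewrite mem_map.
by case: filter.
Qed.

Lemma dfs_rename t g (s : nat -> nat) : s 0 = 0 -> injective s ->
  dfs t (map (rename s) g) = map s (dfs t g).
Proof. by move=> s0 sI; elim: t => [|t IH] /=; [rewrite s0 | exact: eq_dfs_step]. Qed.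

Lemma row_edges_rename g i (s : nat -> nat) : s 0 = 0 ->
  row_edges (map (rename s) g) i = map s (row_edges g i).
Proof.
move=> s0; case: i => [|[|i]]; rewrite /row_edges filter_map.
- rewrite -!map_comp; apply: eq_map => x /=; by case: (outs x).
- rewrite map_flatten -!map_comp; congr flatten; apply: eq_map => x /=.
  by case: (outs x).
- by rewrite map_flatten -!map_comp.
Qed.

Lemma row_labels_rename m g i (s : nat -> nat) : s 0 = 0 -> injective s ->
  row_labels m (map (rename s) g) i = row_labels m g i.
Proof.
move=> s0 sI; rewrite /row_labels dfs_rename // row_edges_rename // -map_comp.
by congr sort; apply: eq_map => e /=; rewrite index_map.
Qed.

Lemma count_flatten_mem (T S : eqType) (f : T -> seq S) s e :
  uniq (flatten (map f s)) -> count (fun x => e \in f x) s <= 1.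
Proof.
move=> u; have : count (pred1 e) (flatten (map f s)) <= 1.
  by rewrite count_uniq_mem //; case: (e \in _).
apply: leq_trans; elim: s {u} => //= x s IH; rewrite count_cat; apply: leq_add IH.
by case: (boolP (e \in f x)) => // h; rewrite -has_count has_pred1.
Qed.

Lemma dfs_perm_eq t g g' : perm_eq g g' -> uniq (flatten (map ins g)) ->
  dfs t g = dfs t g'.
Proof.
move=> hg hu; elim: t => //= t ->; set L := dfs t g'; rewrite /dfs_step.
have -> // : [seq x | e <- rev L, x <- [seq x <- active g L | e \in ins x]] =
  [seq x | e <- rev L, x <- [seq x <- active g' L | e \in ins x]].
congr flatten; apply: eq_map => e; congr map; apply/esym/perm_small_eq.
  rewrite -filter_predI size_filter; apply: leq_trans (count_flatten_mem e hu).
  by apply: sub_count => x /= /andP[].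
by rewrite perm_sym; apply/perm_filter/perm_filter.
Qed.

Lemma row_labels_perm m g g' i : perm_eq g g' -> uniq (flatten (map ins g)) ->
  row_labels m g i = row_labels m g' i.
Proof.
move=> hg hu; rewrite /row_labels (dfs_perm_eq m hg hu).
apply/(perm_sortP leq_total leq_trans anti_leq)/perm_map.
by case: i => [|[|i]]; do ?apply: perm_flatten; apply: perm_map; apply: perm_filter.
Qed.

Lemma eq_rename_fresh (s : nat -> nat) S fr k w : {in [pred e | fr <= e], s =1 id} ->
  graph_from k (map s S) fr w = map (rename s) (graph_from k S fr w).
Proof.
elim: w S fr => [|[[l o] r] w IH] S fr //= hs; set b := arity_out k o.
have hmap : map s (iota fr b) = iota fr b.
  by rewrite -[RHS]map_id; apply/eq_in_map => e; rewrite mem_iota => /andP[/hs].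
rewrite /rename /= /ins /outs /op_of /= map_take map_drop hmap; congr cons.
rewrite -IH => [|e he]; last by apply: hs; move: he; rewrite !inE; lia.
by rewrite !map_cat hmap map_take map_drop.
Qed.

Definition block_swap (fr a b e : nat) : nat :=
  if e < fr then e else if e < fr + a then e + b
  else if e < fr + a + b then e - a else e.

Lemma graph_from_interchange k S fr (u v : seq layer) l m r o1 o2 t :
  composes k (size S)
    (u ++ [:: (l, o1, m + arity_in k o2 + r);
              (l + arity_out k o1 + m, o2, r)] ++ v) t ->
  all (fun e => e < fr) S ->
  exists2 s : nat -> nat,
    injective s /\ {in [pred e | e < fr], s =1 id} &
    perm_eq
      (graph_from k S fr
        (u ++ [:: (l + arity_in k o1 + m, o2, r);
                  (l, o1, m + arity_out k o2 + r)] ++ v))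
      (map (rename s) (graph_from k S fr
        (u ++ [:: (l, o1, m + arity_in k o2 + r);
                  (l + arity_out k o1 + m, o2, r)] ++ v))).
Proof.
elim: u S fr => [|[[l' o'] r'] u IH] S fr /=; last first.
  case/andP=> /eqP hS hw ltS; set a := arity_in k o' in hS hw *; set b := arity_out k o' in hw *.
  set S' := _ ++ _.
  have szS' : size S' = l' + b + r'.
    rewrite !size_cat size_iota size_drop size_takel ?hS; lia.
  have ltS' : all (fun e => e < fr + b) S'.
    apply/allP => e; rewrite !mem_cat mem_iota => /or3P[/mem_take/(allP ltS)||/mem_drop/(allP ltS)];
      lia.
  rewrite -szS' in hw; have [s [sI sid] hp] := IH S' (fr + b) hw ltS'.
  exists s; first by split=> // e; rewrite inE => he; apply: sid; rewrite inE; lia.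
  have -> : rename s (o', take a (drop l' S), iota fr b) = (o', take a (drop l' S), iota fr b).
    rewrite /rename /op_of /ins /outs /=; congr (_, _, _); rewrite -[RHS]map_id; apply/eq_in_map => e.
      move=> /mem_take/mem_drop/(allP ltS) he; apply: sid; rewrite inE; lia.
    by rewrite mem_iota => he; apply: sid; rewrite inE; lia.
  by rewrite perm_cons.
case/and3P=> /eqP hS _ _ ltS.
set a1 := arity_in k o1 in hS *; set a2 := arity_in k o2 in hS *.
set b1 := arity_out k o1; set b2 := arity_out k o2.
pose A := take l S; pose I1 := take a1 (drop l S).
pose M := take m (drop (l + a1) S); pose I2 := take a2 (drop (l + a1 + m) S).
pose R := drop (l + a1 + m + a2) S.
have eS : S = A ++ I1 ++ M ++ I2 ++ R.
  have step d n : take n (drop d S) ++ drop (d + n) S = drop d S.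
    by rewrite [d + n]addnC -drop_drop cat_take_drop.
  by rewrite /A /I1 /M /I2 /R !step cat_take_drop.
have szA : size A = l by rewrite size_takel //; lia.
have szI1 : size I1 = a1 by rewrite size_takel // size_drop; lia.
have szM : size M = m by rewrite size_takel // size_drop; lia.
have szI2 : size I2 = a2 by rewrite size_takel // size_drop; lia.
clearbody A I1 M I2 R; subst S.
pose s := block_swap fr b1 b2.
have sid e : e < fr -> s e = e by rewrite /s /block_swap => ->.
have sI : injective s by move=> x y; rewrite /s /block_swap; do !case: ifP; lia.
have sfr e : fr + b1 + b2 <= e -> s e = e.
  by move=> he; rewrite /s /block_swap; do !case: ifP => ?; lia.
have s1 : map s (iota fr b1) = iota (fr + b2) b1.
  rewrite addnC iotaDl; apply/eq_in_map => e; rewrite mem_iota /s /block_swap.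
  by do !case: ifP => ?; lia.
have s2 : map s (iota (fr + b1) b2) = iota fr b2.
  rewrite addnC iotaDl -map_comp -[RHS]map_id; apply/eq_in_map => e.
  by rewrite mem_iota /s /block_swap /=; do !case: ifP => ?; lia.
have smap (B : seq nat) : {subset B <= A ++ I1 ++ M ++ I2 ++ R} -> map s B = B.
  by move=> h; rewrite -[RHS]map_id; apply/eq_in_map => e /h/(allP ltS)/sid.
have [sA sI1 sM sI2 sR] : [/\ map s A = A, map s I1 = I1, map s M = M, map s I2 = I2 & map s R = R].
  by split; apply: smap => e he; rewrite !mem_cat he ?orbT.
exists s; first by split=> // e; rewrite inE => /sid.
have tk (x y : seq nat) n : size x = n -> take n (x ++ y) = x by move=> <-; rewrite take_size_cat.
have dr (x y : seq nat) n : size x = n -> drop n (x ++ y) = y by move=> <-; rewrite drop_size_cat.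
have d1 : drop l (A ++ I1 ++ M ++ I2 ++ R) = I1 ++ M ++ I2 ++ R by rewrite dr.
have d2 : drop (l + a1) (A ++ I1 ++ M ++ I2 ++ R) = M ++ I2 ++ R.
  by rewrite catA dr // size_cat szA szI1.
have d3 : drop (l + a1 + m) (A ++ I1 ++ M ++ I2 ++ R) = I2 ++ R.
  by rewrite catA catA dr // !size_cat szA szI1 szM.
have d4 : drop (l + a1 + m + a2) (A ++ I1 ++ M ++ I2 ++ R) = R.
  by rewrite !catA dr // !size_cat szA szI1 szM szI2.
have t3 : take (l + a1 + m) (A ++ I1 ++ M ++ I2 ++ R) = A ++ I1 ++ M.
  by rewrite catA catA tk ?catA // !size_cat szA szI1 szM.
rewrite d1 d2 d3 d4 t3 -!catA.
have tkA (B : seq nat) : take l (A ++ B) = A by rewrite tk.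
have drA (B : seq nat) : drop l (A ++ B) = B by rewrite dr.
have tk1 (B : seq nat) : take a1 (I1 ++ B) = I1 by rewrite tk.
have tk2 (B : seq nat) : take a2 (I2 ++ B) = I2 by rewrite tk.
have e1 (B : seq nat) : drop (l + a1) (A ++ I1 ++ B) = B.
  by rewrite catA dr // size_cat szA szI1.
have e2 (B C : seq nat) : size C = b1 -> drop (l + b1 + m) (A ++ C ++ M ++ B) = B.
  by move=> szC; rewrite catA catA dr // !size_cat szA szC szM.
have e3 (B C : seq nat) : size C = b1 -> take (l + b1 + m) (A ++ C ++ M ++ B) = A ++ C ++ M.
  by move=> szC; rewrite catA catA tk ?catA // !size_cat szA szC szM.
have e4 (B C : seq nat) : size C = b1 -> drop (l + b1 + m + a2) (A ++ C ++ M ++ I2 ++ B) = B.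
  by move=> szC; rewrite !catA dr // !size_cat szA szC szM szI2.
rewrite !tkA !drA !tk1 !e1 e2 ?e3 ?e4 ?size_iota // !tk2 -!catA.
rewrite {1 2}/rename /op_of /ins /outs /= s1 s2 sI1 sI2.
rewrite -eq_rename_fresh => [|e]; last by rewrite inE => /sfr.
rewrite !map_cat s1 s2 sA sM sR [fr + b2 + b1]addnAC.
exact: (permEl (perm_catCA [:: _] [:: _] _)).
Qed.

Lemma row_labels_interchange k n w1 w2 i : closed_word k n w1 ->
  interchange k w1 w2 ->
  row_labels (k.+1 * n) (graph k w1) i = row_labels (k.+1 * n) (graph k w2) i.
Proof.
move=> hw hi; case: hi hw => u v l m r o1 o2 hw.
have [_ hu _ _] := graph_well_formed hw; have /and3P[hc _ _] := hw.
have [s [sI sid] hp] := @graph_from_interchange k [:: 0] 1 _ _ _ _ _ _ _ _ hc isT.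
have s0 : s 0 = 0 by rewrite sid.
apply/esym; rewrite -[RHS](row_labels_rename _ _ _ s0 sI).
apply: row_labels_perm => //; rewrite (perm_uniq (perm_flatten (perm_map ins hp))).
have -> : map ins (map (rename s) (graph k (u ++ [:: (l, o1, m + arity_in k o2 + r);
   (l + arity_out k o1 + m, o2, r)] ++ v))) = map (map s) (map ins (graph k (u ++
   [:: (l, o1, m + arity_in k o2 + r); (l + arity_out k o1 + m, o2, r)] ++ v))).
  by rewrite -!map_comp.
by rewrite -map_flatten map_inj_uniq.
Qed.

(* Phi does not depend on the word chosen to represent a prograph. *)
Lemma Phi_pi k n (hk : 1 < k) (w : word k n) :
  Phi hk (\pi_(prograph k n) w) = Phi_word hk w.
Proof.
unlock Phi; set w' := repr _.
have /asboolP : isotopic w' w.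
  by rewrite -[isotopic _ _]/(isotopic_equiv k n _ _) -eqmodE reprK.
elim=> [x y h|x|x y _ ->|x y z _ -> _ ->] //.
apply: val_inj; apply/ffunP => c; rewrite !ffunE; apply/setP => a; rewrite !inE.
by rewrite (row_labels_interchange _ (valP x) h).
Qed.

(* Main.v *)
Require Import Defs.
From mathcomp Require Import all_boot.
From mathcomp Require Import zify.

(** The depth-left first search lists the edges of a closed prograph in a planar
linear order: e precedes f when f is reachable from e or e lies to the left
of f. The half turn with reversal of the edges reverses both relations, so the search of r(G)
lists the edges of G backwards. In this order the first outgoing edge of a node
immediately follows its last incoming edge; hence an edge of label a is a
leftmost coproduct child of r(G) (the last input of a product of G) exactly when
the label (k+1)n - a + 1 is the output of a product of G, and symmetrically
for the product children of r(G). The middle row follows by complement. *)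

Set Implicit Arguments.
Unset Strict Implicit.
Unset Printing Implicit Defensive.

Definition insert_after (p : nat) (N O : seq nat) : seq nat :=
  flatten [seq (if e == p then e :: N else [:: e]) | e <- O].

Definition insert_before (q : nat) (I O : seq nat) : seq nat :=
  flatten [seq (if e == q then rcons I e else [:: e]) | e <- O].

Lemma insert_after_cat p N O O' :
  insert_after p N (O ++ O') = insert_after p N O ++ insert_after p N O'.
Proof. by rewrite /insert_after map_cat flatten_cat. Qed.

Lemma insert_before_cat q I O O' :
  insert_before q I (O ++ O') = insert_before q I O ++ insert_before q I O'.
Proof. by rewrite /insert_before map_cat flatten_cat. Qed.

Lemma insert_after_notin p N O : p \notin O -> insert_after p N O = O.
Proof.
rewrite /insert_after; elim: O => //= e O IH; rewrite in_cons negb_or eq_sym.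
by case/andP=> /negPf-> /IH ->.
Qed.

Lemma insert_before_notin q I O : q \notin O -> insert_before q I O = O.
Proof.
rewrite /insert_before; elim: O => //= e O IH; rewrite in_cons negb_or eq_sym.
by case/andP=> /negPf-> /IH ->.
Qed.

Lemma insert_afterE p N P Q : uniq (P ++ p :: Q) ->
  insert_after p N (P ++ p :: Q) = P ++ p :: N ++ Q.
Proof.
rewrite cat_uniq /= negb_or -andbA => /and4P[_ pP _ /andP[pQ _]].
rewrite insert_after_cat insert_after_notin //; congr (_ ++ _).
by rewrite /insert_after /= eqxx -/(insert_after p N Q) insert_after_notin.
Qed.

Lemma insert_beforeE q I P Q : uniq (P ++ q :: Q) ->
  insert_before q I (P ++ q :: Q) = P ++ I ++ q :: Q.
Proof.
rewrite cat_uniq /= negb_or -andbA => /and4P[_ pP _ /andP[pQ _]].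
rewrite insert_before_cat insert_before_notin //; congr (_ ++ _).
rewrite /insert_before /= eqxx -/(insert_before q I Q) insert_before_notin //.
by rewrite cat_rcons.
Qed.

Lemma rev_insert_before q I O :
  rev (insert_before q I O) = insert_after q (rev I) (rev O).
Proof.
elim: O => //= e O IH; rewrite rev_cons -cats1 insert_after_cat -IH rev_cat.
by rewrite /insert_after /=; case: eqP => _ //=; rewrite rev_rcons cats0.
Qed.

Lemma insert_after_map (s : nat -> nat) p N O : injective s ->
  insert_after (s p) (map s N) (map s O) = map s (insert_after p N O).
Proof.
move=> sI; rewrite /insert_after map_flatten -!map_comp; congr flatten.
by apply/eq_map => e /=; rewrite (inj_eq sI); case: eqP.
Qed.

Lemma insert_after_before (x y : nat) (N I O : seq nat) : x \notin I -> y \notin N ->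
  insert_after x N (insert_before y I O) = insert_before y I (insert_after x N O).
Proof.
move=> xI yN; elim: O => // e O IH.
rewrite -cat1s insert_before_cat [LHS]insert_after_cat insert_after_cat [RHS]insert_before_cat IH.
congr (_ ++ _).
have iA a : insert_after x N [:: a] = if a == x then a :: N else [:: a].
  by rewrite /insert_after /= cats0.
have iB a : insert_before y I [:: a] = if a == y then rcons I a else [:: a].
  by rewrite /insert_before /= cats0.
rewrite (iA e) (iB e); case: (eqVneq e y) => ey; case: (eqVneq e x) => ex.
- rewrite -cats1 insert_after_cat insert_after_notin // iA ex eqxx.
  rewrite -cat1s insert_before_cat (insert_before_notin _ yN) iB -ex ey eqxx.
  by rewrite -cats1 -catA.
- rewrite -cats1 insert_after_cat insert_after_notin // iA iB (negPf ex) ey eqxx.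
  by rewrite cats1.
- rewrite iA ex eqxx -cat1s insert_before_cat (insert_before_notin _ yN).
  by rewrite iB -ex (negPf ey).
- by rewrite iA iB (negPf ex) (negPf ey).
Qed.

(* The edges created by a node come right after its last input; read from the
   top, the edges consumed by a node come right before its first output. *)
Definition planar_order (O : seq nat) (g : seq node) : seq nat :=
  foldl (fun O' x => insert_after (last 0 (ins x)) (outs x) O') O g.

Definition planar_coorder (T : seq nat) (g : seq node) : seq nat :=
  foldr (fun x O => insert_before (head 0 (outs x)) (ins x) O) T g.

Definition flip (x : node) : node := (dual (op_of x), rev (outs x), rev (ins x)).

Lemma head_rev (T : Type) (x : T) s : head x (rev s) = last x s.
Proof. by case: (lastP s) => // s' y; rewrite rev_rcons last_rcons. Qed.

Lemma last_rev (T : Type) (x : T) s : last x (rev s) = head x s.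
Proof. by rewrite -head_rev revK. Qed.

Lemma rev_planar_coorder T g : rev (planar_coorder T g) = planar_order (rev T) (rev (map flip g)).
Proof.
rewrite /planar_order foldl_rev; elim: g => //= x g IH.
by rewrite rev_insert_before IH last_rev.
Qed.

(* [drawing k S w g T]: the nodes g draw the word w from the strands S up to the
   strands T, with arbitrary names for the edges. *)
Inductive drawing (k : nat) :
    seq nat -> seq layer -> seq node -> seq nat -> Prop :=
| DrawingNil S : drawing k S [::] [::] S
| DrawingCons A I N C o w g T :
    size I = arity_in k o -> size N = arity_out k o ->
    drawing k (A ++ N ++ C) w g T ->
    drawing k (A ++ I ++ C) ((size A, o, size C) :: w) ((o, I, N) :: g) T.

Lemma drawing_cat k S w g S' w' g' T :
  drawing k S w g S' -> drawing k S' w' g' T ->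
  drawing k S (w ++ w') (g ++ g') T.
Proof. by elim=> //= A I N C o v h U hI hN _ IH /IH; exact: DrawingCons. Qed.

Lemma drawing_flip k S w g T : drawing k S w g T ->
  drawing k (rev T) (rotate_layers w) (rev (map flip g)) (rev S).
Proof.
elim=> [{}S|A I N C o {}w {}g {}T hI hN _ IH]; first exact: DrawingNil.
rewrite /rotate_layers !map_cons !rev_cons -!cats1; apply: drawing_cat IH _.
rewrite !rev_cat -!catA -(size_rev A) -(size_rev C).
apply: DrawingCons; rewrite ?size_rev ?arity_in_dual ?arity_out_dual //.
exact: DrawingNil.
Qed.

Lemma drawing_graph_from k S fr w t : composes k (size S) w t ->
  exists2 T, drawing k S w (graph_from k S fr w) T & size T = t.
Proof.
elim: w S fr => [|[[l o] r] w IH] S fr /=.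
  by move/eqP=> <-; exists S => //; exact: DrawingNil.
case/andP=> /eqP hS hw.
have sA : size (take l S) = l by rewrite size_takel //; lia.
have sC : size (drop (l + arity_in k o) S) = r by rewrite size_drop; lia.
have eS : S = take l S ++ take (arity_in k o) (drop l S) ++ drop (l + arity_in k o) S.
  by rewrite addnC -drop_drop !cat_take_drop.
have [|T hT sT] := IH (take l S ++ iota fr (arity_out k o) ++
    drop (l + arity_in k o) S) (fr + arity_out k o).
  by rewrite !size_cat sA sC size_iota addnA.
exists T => //; have := DrawingCons (I := take (arity_in k o) (drop l S)) _ _ hT.
rewrite sA sC -eS; apply; last exact: size_iota.
by rewrite size_takel // size_drop; lia.
Qed.

Lemma drawing_perm k S w g T : drawing k S w g T ->
  perm_eq (S ++ flatten (map outs g)) (flatten (map ins g) ++ T).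
Proof.
elim=> [{}S|A I N C o {}w {}g {}T hI hN _ IH] /=; first by rewrite cats0.
rewrite {1}/ins {1}/outs /=.
have : perm_eq ((A ++ I ++ C) ++ N ++ flatten (map outs g))
               (I ++ (A ++ N ++ C) ++ flatten (map outs g)).
  by apply/permP => P; rewrite !count_cat; lia.
by move=> hp; apply: perm_trans hp _; rewrite -[X in perm_eq _ X]catA perm_cat2l.
Qed.

Lemma mem_drawing_ins k S w g T e : drawing k S w g T ->
  e \in flatten (map ins g) -> e \in S ++ flatten (map outs g).
Proof. by move/drawing_perm/perm_mem->; rewrite mem_cat => ->. Qed.

Lemma drawing_rename k S w g T S' g' T' s :
  drawing k S w g T -> drawing k S' w g' T' -> map s S = S' ->
  map s (flatten (map outs g)) = flatten (map outs g') -> g' = map (rename s) g.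
Proof.
move=> h; elim: h S' g' => [{}S|A I N C o {}w {}g {}T hI hN _ IH] S' g' h'.
  by inversion h'.
inversion h' as [|A' I' N' C' o' w' g'' T'' hI' hN' hd e1 e2 e3 e4]; subst.
rewrite !map_cat => /eqP; rewrite eqseq_cat ?size_map // => /andP[/eqP eA].
rewrite eqseq_cat ?size_map ?hI ?hI' // => /andP[/eqP eI /eqP eC].
move=> /eqP; rewrite eqseq_cat ?size_map ?hN ?hN' //.
case/andP=> /eqP eN /eqP eg.
rewrite (IH _ _ hd) //; last by rewrite !map_cat eA eN eC.
by rewrite /rename /op_of /ins /outs /= eI eN.
Qed.

Lemma drawing_nonempty k S w g T x : 0 < k -> drawing k S w g T -> x \in g ->
  ins x != [::] /\ outs x != [::].
Proof.
move=> k0; elim=> // A I N C o {}w {}g {}T hI hN _ IH.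
rewrite in_cons => /orP[/eqP->|] //; rewrite /ins /outs /= -!size_eq0 hI hN.
by case: o {hI hN} => /=; lia.
Qed.

Lemma last_mem (s : seq nat) : s != [::] -> last 0 s \in s.
Proof. by case: s => //= a s _; exact: mem_last. Qed.

Lemma head_mem (s : seq nat) : s != [::] -> head 0 s \in s.
Proof. by case: s => //= a s _; exact: mem_head. Qed.

Lemma planar_order_insert_before q I O g :
  {in g, forall x, last 0 (ins x) \notin I} ->
  {in g, forall x, q \notin outs x} ->
  planar_order (insert_before q I O) g = insert_before q I (planar_order O g).
Proof.
elim: g O => //= x g IH O hl hq.
rewrite insert_after_before ?hl ?hq ?mem_head //.
by apply: IH => y yg; [apply: hl | apply: hq]; rewrite in_cons yg orbT.
Qed.

Lemma planar_order_coorder k S w g T : 0 < k -> drawing k S w g T ->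
  uniq (S ++ flatten (map outs g)) -> planar_order S g = planar_coorder T g.
Proof.
move=> k0; elim=> // A I N C o {}w {}g {}T hI hN hd IH.
rewrite /= {1}/outs /= => u.
have u' : uniq (I ++ (A ++ N ++ C) ++ flatten (map outs g)).
  rewrite (perm_uniq (s2 := (A ++ I ++ C) ++ N ++ flatten (map outs g))) //.
  by apply/permP => P; rewrite !count_cat; lia.
have [uI /hasPn dI uS] := and3P (etrans (esym (cat_uniq _ _)) u').
rewrite -IH // /ins /outs /=.
have nI : I != [::] by rewrite -size_eq0 hI; case: (o) => /=; lia.
have nN : N != [::] by rewrite -size_eq0 hN; case: (o) => /=; lia.
have [I1 [p eI]] : exists I1 p, I = rcons I1 p.
  by case: (lastP I) nI => // I1 p _; exists I1, p.
have [q [N1 eN]] : exists q N1, N = q :: N1.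
  by case: (N) nN => // q N1 _; exists q, N1.
have uA : uniq (A ++ N ++ C) by move: uS; rewrite cat_uniq => /andP[].
rewrite -planar_order_insert_before.
- congr planar_order; move: u uA; rewrite eI eN last_rcons /=.
  rewrite cat_uniq => /andP[u _] uA; rewrite insert_beforeE //.
  move: u; rewrite cat_rcons catA => u; rewrite insert_afterE //.
  by rewrite cat_rcons -catA.
- move=> x xg; have hx : last 0 (ins x) \in flatten (map ins g).
    apply/flatten_mapP; exists x => //.
    by apply: last_mem; have [] := drawing_nonempty k0 hd xg.
  exact: dI (mem_drawing_ins hd hx).
- move=> x xg; apply/negP => hx; move: uS; rewrite cat_uniq => /and3P[_ /hasPn h _].
  have /h : head 0 N \in flatten (map outs g) by apply/flatten_mapP; exists x.
  by rewrite /= !mem_cat head_mem // orbT.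
Qed.

Lemma planar_order_cons a O g : exists O', planar_order (a :: O) g = a :: O'.
Proof.
elim: g O => /= [|x g IH] O; first by exists O.
by rewrite /insert_after /=; case: eqP => _ /=; exact: IH.
Qed.

Lemma perm_insert_after p N O : p \in O -> uniq O ->
  perm_eq (insert_after p N O) (O ++ N).
Proof.
move=> hp; have [P [Q ->]] : exists P Q, O = P ++ p :: Q.
  by case/splitPr: hp => P Q; exists P, Q.
move=> u; rewrite insert_afterE //.
by apply/permP => R; rewrite !count_cat /= !count_cat; lia.
Qed.

Lemma planar_order_map (s : nat -> nat) O g : injective s ->
  {in g, forall x, ins x != [::]} ->
  planar_order (map s O) (map (rename s) g) = map s (planar_order O g).
Proof.
move=> sI; elim: g O => //= x g IH O hg.
rewrite -IH => [|y yg]; last by apply: hg; rewrite in_cons yg orbT.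
congr planar_order; rewrite -insert_after_map //; congr insert_after.
have := hg x (mem_head _ _); rewrite -[ins (rename s x)]/(map s (ins x)).
by case: (ins x) => //= a I _; rewrite last_map.
Qed.

Lemma injective_extension (E E' : seq nat) : uniq E -> uniq E' ->
  size E = size E' -> exists2 s : nat -> nat, injective s & map s E = E'.
Proof.
move=> uE uE' sE; pose M := \max_(e <- E') e.
have leM e : e \in E' -> e <= M by move=> h; exact: leq_bigmax_seq.
pose s e := if e \in E then nth 0 E' (index e E) else (M + e).+1.
have hs e : e \in E -> s e = nth 0 E' (index e E) by rewrite /s => ->.
have sM e : e \in E -> s e <= M.
  by move=> he; rewrite hs //; apply: leM; rewrite mem_nth // -sE index_mem.
have sN e : e \notin E -> s e = (M + e).+1 by rewrite /s => /negPf->.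
exists s => [a b|]; last first.
  apply: (@eq_from_nth _ 0); rewrite size_map // => i hi.
  by rewrite (nth_map 0) // hs ?mem_nth // index_uniq.
have [aE|aE] := boolP (a \in E); have [bE|bE] := boolP (b \in E).
- move/eqP; rewrite !hs // nth_uniq // -?sE ?index_mem //.
  by move/eqP/(congr1 (nth 0 E)); rewrite !nth_index.
- by have := sM a aE; rewrite (sN b bE); clearbody s M; lia.
- by have := sM b bE; rewrite (sN a aE); clearbody s M; lia.
- by rewrite !sN //; lia.
Qed.

Definition earlier (O : seq nat) : rel nat := fun a b => index a O < index b O.

Lemma earlier_trans O : transitive (earlier O).
Proof. by move=> b a c; exact: ltn_trans. Qed.

Lemma ltn_shift i a b n :
  (a + (if i < a then n else 0) < b + (if i < b then n else 0)) = (a < b).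
Proof. by do 2 case: ifP; lia. Qed.

Lemma index_insert_after p N O e : p \in O -> uniq (O ++ N) ->
  index e (insert_after p N O) =
  if e \in N then (index p O).+1 + index e N
  else index e O + (if earlier O p e then size N else 0).
Proof.
move=> hp; have [P [Q ->]] : exists P Q, O = P ++ p :: Q.
  by case/splitPr: hp => P Q; exists P, Q.
rewrite /earlier cat_uniq => /and3P[u /hasPn hN _].
rewrite insert_afterE // !index_cat /= !index_cat eqxx addn0.
have pP : p \notin P by move: u; rewrite cat_uniq /= negb_or -!andbA => /and3P[].
rewrite (negPf pP).
have [eN|_] := boolP (e \in N).
  have := hN _ eN; rewrite mem_cat in_cons !negb_or => /and3P[/negPf-> ep _].
  by rewrite eq_sym (negPf ep) addSnnS.
have [eP|_] := boolP (e \in P); first by rewrite ltnNge ltnW ?addn0 // index_mem.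
case: eqVneq => _; first by rewrite !addn0 ltnn addn0.
by rewrite !addnS ltnS leq_addr addSn addnAC -addnA.
Qed.

(* The field [df_nested] says that the order is the preorder of the forest in
   which the children of an edge are the outputs of the node whose last input it is: the
   families of children of two edges do not cross. *)
Record depth_first (g : seq node) (S O : seq nat) : Prop := DepthFirst {
  df_uniq : uniq O;
  df_sub : {subset S <= O};
  df_strands : pairwise (earlier O) S;
  df_nil : {in g, forall x, ins x != [::] /\ outs x != [::]};
  df_mem : {in g, forall x, {subset ins x ++ outs x <= O}};
  df_last : {in g, forall x, last 0 (ins x) \notin S};
  df_ins : {in g, forall x, pairwise (earlier O) (ins x)};
  df_outs : {in g, forall x, pairwise (earlier O) (outs x)};
  df_next : {in g, forall x,
    index (head 0 (outs x)) O = (index (last 0 (ins x)) O).+1};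
  df_nested : {in g &, forall u v e d, e \in outs v -> d \in outs u ->
    earlier O (last 0 (ins v)) (last 0 (ins u)) ->
    earlier O (last 0 (ins u)) e -> earlier O e d -> False}
}.

Lemma pairwise_earlier_uniq N : uniq N -> pairwise (earlier N) N.
Proof.
move=> u; apply/(pairwiseP 0) => i j; rewrite !inE /earlier => hi hj hij.
by rewrite !index_uniq.
Qed.

Lemma depth_first_step A I N C o g O :
  I != [::] -> N != [::] -> uniq (A ++ I ++ C) -> uniq (O ++ N) ->
  depth_first g (A ++ I ++ C) O ->
  depth_first (rcons g (o, I, N)) (A ++ N ++ C) (insert_after (last 0 I) N O).
Proof.
move=> nI nN uS uON [uO sS pS h0 hm hl hi ho hn hc].
have [p ep] : exists p, last 0 I = p by exists (last 0 I).
rewrite ep; have pI : p \in I by rewrite -ep; exact: last_mem.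
have pO : p \in O by apply: sS; rewrite !mem_cat pI orbT.
have NO e : e \in N -> e \notin O.
  by move: uON; rewrite cat_uniq => /and3P[_ /hasPn h _] /h.
have ON e : e \in O -> e \notin N by move=> eO; apply/negP => /NO; rewrite eO.
have sN : 0 < size N by rewrite lt0n size_eq0.
set O' := insert_after p N O.
have idx e : e \in O -> index e O' = index e O + (if earlier O p e then size N else 0).
  by move=> eO; rewrite index_insert_after // (negPf (ON e eO)).
have idN e : e \in N -> index e O' = (index p O).+1 + index e N.
  by move=> eN; rewrite index_insert_after // eN.
have ltN e : e \in N -> index e N < size N by rewrite index_mem.
have uO' : uniq O'.
  by rewrite (perm_uniq (perm_insert_after _ pO _)).
have memO' e : (e \in O') = (e \in O) || (e \in N).
  by rewrite (perm_mem (perm_insert_after _ pO _)) // mem_cat.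
clearbody O'.
have mono a b : a \in O -> b \in O -> earlier O' a b = earlier O a b.
  move=> aO bO; rewrite /earlier (idx a) // (idx b) //; exact: ltn_shift.
have injO a b : a \in O -> index a O = index b O -> a = b.
  by move=> aO e; rewrite -(nth_index 0 aO) e nth_index // -index_mem -e index_mem.
have pw s : {subset s <= O} -> pairwise (earlier O) s -> pairwise (earlier O') s.
  move=> h; rewrite (eq_in_pairwise (P := [in O]) (r' := earlier O')) //; last exact/allP.
  by move=> a b aO bO; rewrite mono.
have nS a : a \in A -> earlier O a p.
  move=> aA; move: pS; rewrite !pairwise_cat => /and3P[/allrelP h _ _].
  by apply: h; rewrite // mem_cat pI.
have pC a : a \in C -> earlier O p a.
  move=> aC; move: pS; rewrite !pairwise_cat => /and3P[_ _ /and3P[/allrelP h _ _]]; exact: h.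
have sA : {subset A <= O} by move=> a aA; apply: sS; rewrite mem_cat aA.
have sI : {subset I <= O} by move=> a aI; apply: sS; rewrite !mem_cat aI orbT.
have sC : {subset C <= O} by move=> a aC; apply: sS; rewrite !mem_cat aC !orbT.
have pN : pairwise (earlier O') N.
  have uN : uniq N by move: uON; rewrite cat_uniq => /and3P[].
  rewrite -(eq_in_pairwise (P := [in N]) (r := earlier N)); last 2 first.
  - by move=> a b aN bN; rewrite /earlier !idN // ltn_add2l.
  - exact/allP.
  exact: pairwise_earlier_uniq.
have memO x : x \in g -> {subset ins x <= O} /\ {subset outs x <= O}.
  by move=> xg; split=> e ex; apply: (hm x xg); rewrite mem_cat ex ?orbT.
have gP (P : node -> Prop) : {in g, forall x, P x} -> P (o, I, N) ->
    {in rcons g (o, I, N), forall x, P x}.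
  by move=> hP hx x; rewrite mem_rcons in_cons => /orP[/eqP->|/hP].
have lO x : x \in g -> last 0 (ins x) \in O.
  by move=> xg; have [h _] := memO x xg; apply: h; apply: last_mem; have [] := h0 x xg.
have hO x : x \in g -> head 0 (outs x) \in O.
  by move=> xg; have [_ h] := memO x xg; apply: h; apply: head_mem; have [] := h0 x xg.
have lp x : x \in g -> last 0 (ins x) != p.
  move=> xg; apply/eqP => e; move: (hl x xg); rewrite e !mem_cat pI orbT //.
split=> //.
- move=> e; rewrite memO' !mem_cat => /or3P[/sA->|->|/sC->] //; exact: orbT.
- rewrite !pairwise_cat pN /= !pw //; last 2 first.
  + by move: pS; rewrite !pairwise_cat => /and3P[_ _ /and3P[]].
  + by move: pS; rewrite !pairwise_cat => /and3P[].
  rewrite !andbT; apply/andP; split.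
    apply/allrelP => a b aA; rewrite mem_cat => /orP[bN|bC].
      rewrite /earlier (idN b bN) (idx a (sA a aA)).
      move: (nS a aA); rewrite /earlier; clear; case: ifP; lia.
    by rewrite (mono a b (sA a aA) (sC b bC)); exact: earlier_trans (nS a aA) (pC b bC).
  apply/allrelP => a b aN bC; rewrite /earlier (idN a aN) (idx b (sC b bC)) pC //.
  by move: (pC b bC) (ltN a aN); rewrite /earlier; clear; lia.
- by apply: gP.
- apply: gP => [x xg e|e]; rewrite memO'; first by move/(hm x xg) ->.
  by rewrite mem_cat => /orP[/sI->|->] //; exact: orbT.
- apply: gP => [x xg|].
    move: (hl x xg); rewrite !mem_cat !negb_or => /and3P[-> _ ->].
    by rewrite andbT; exact: ON (lO x xg).
  rewrite /ins /= ep /= !mem_cat !negb_or (ON p pO) /=; apply/andP; split.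
    by apply/negP => /nS; rewrite /earlier ltnn.
  by apply/negP => /pC; rewrite /earlier ltnn.
- apply: gP => [x xg|]; first by apply: pw; [have [] := memO x xg | exact: hi].
  by apply: pw => //; move: pS; rewrite !pairwise_cat => /and3P[_ _ /and3P[]].
- by apply: gP => [x xg|] //; apply: pw; [have [] := memO x xg | exact: ho].
- apply: gP => [x xg|]; last first.
    rewrite /ins /outs /= ep (idN _ (head_mem nN)) (idx p pO) /earlier ltnn addn0.
    by case: (N) nN => //= a N' _; rewrite eqxx addn0.
  have := hn x xg; rewrite (idx _ (hO x xg)) (idx _ (lO x xg)) /earlier => ->.
  have : index p O != index (last 0 (ins x)) O.
    by apply/eqP => /(injO p _ pO) e; move: (lp x xg); rewrite -e eqxx.
  clear; do 2 case: ifP; lia.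
- move=> u v; rewrite !mem_rcons !in_cons => /orP[/eqP->|ug] /orP[/eqP->|vg] e d;
    rewrite /outs /ins /= ?ep => ev du.
  + by rewrite /earlier ltnn.
  + have [_ /(_ e ev) eO] := memO v vg.
    rewrite /earlier (idN d du) (idx p pO) (idx e eO) /earlier ltnn addn0 => _.
    by move: (ltN d du); clear; case: ifP; lia.
  + rewrite /earlier (idN e ev) (idx p pO) (idx _ (lO u ug)) /earlier ltnn addn0.
    by move: (ltN e ev); clear; case: ifP; lia.
  + have [_ /(_ e ev) eO] := memO v vg; have [_ /(_ d du) dO] := memO u ug.
    rewrite !mono ?lO //; exact: hc.
Qed.

Lemma depth_first_order k S w g T h O : 0 < k -> drawing k S w g T ->
  uniq (O ++ flatten (map outs g)) -> uniq (S ++ flatten (map outs g)) ->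
  depth_first h S O -> depth_first (h ++ g) T (planar_order O g).
Proof.
move=> k0 hd; elim: hd h O => [{}S|A I N C o {}w {}g {}T hI hN hd IH] h O.
  by rewrite cats0.
rewrite /= {1 2}/outs /= catA => uO uS hf.
have nI : I != [::] by rewrite -size_eq0 hI; case: (o) => /=; lia.
have nN : N != [::] by rewrite -size_eq0 hN; case: (o) => /=; lia.
have pO : last 0 I \in O.
  by apply: (df_sub hf); rewrite !mem_cat last_mem ?orbT.
have uON : uniq (O ++ N) by move: uO; rewrite cat_uniq => /andP[].
have uO1 : uniq O := df_uniq hf.
rewrite -cat_rcons; apply: IH.
- rewrite -(perm_uniq (s1 := (O ++ N) ++ flatten (map outs g))) //.
  by rewrite perm_cat2r perm_sym; exact: perm_insert_after.
- have : uniq (I ++ (A ++ N ++ C) ++ flatten (map outs g)).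
    rewrite (perm_uniq (s2 := (A ++ I ++ C) ++ N ++ flatten (map outs g))) //.
    by apply/permP => P; rewrite !count_cat; lia.
  by rewrite cat_uniq => /and3P[].
- apply: depth_first_step => //.
  by move: uS; rewrite [in X in X -> _]cat_uniq => /andP[].
Qed.

Lemma depth_first_graph k w g T : 0 < k -> drawing k [:: 0] w g T ->
  uniq (0 :: flatten (map outs g)) -> depth_first g T (planar_order [:: 0] g).
Proof.
move=> k0 hd u; rewrite -[g in depth_first g]/([::] ++ g).
apply: depth_first_order hd _ _ _ => //; split=> //.
Qed.

Lemma mem_planar_order O g e : e \in planar_order O g -> e \in O ++ flatten (map outs g).
Proof.
elim: g O => /= [|x g IH] O; first by rewrite cats0.
move/IH; rewrite !mem_cat => /orP[|->]; last by rewrite !orbT.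
case/flatten_mapP => a aO; case: eqP => _; rewrite !in_cons.
  by case/orP=> [/eqP->|->]; rewrite ?aO ?orbT.
by rewrite orbF => /eqP->; rewrite aO.
Qed.

Lemma earlier_last O s a : pairwise (earlier O) s -> a \in s ->
  index a O <= index (last 0 s) O.
Proof.
case: (lastP s) => // s' b; rewrite last_rcons pairwise_rcons => /andP[/allP h _].
by rewrite mem_rcons in_cons => /orP[/eqP->|/h /ltnW].
Qed.

Lemma earlier_head O s a : pairwise (earlier O) s -> a \in s ->
  index (head 0 s) O <= index a O.
Proof.
case: s => //= b s /andP[/allP h _].
by rewrite in_cons => /orP[/eqP->|/h /ltnW].
Qed.

Lemma head_filter_pairwise O s (P : pred nat) e : pairwise (earlier O) s ->
  e \in s -> P e -> {in s, forall a, earlier O a e -> ~~ P a} ->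
  head 0 (filter P s) = e.
Proof.
move=> hs es; case/splitPr: s / es hs => s1 s2 hs Pe h; rewrite filter_cat /= Pe.
rewrite (eq_in_filter (a2 := pred0)) ?filter_pred0 // => a as1.
apply/negbTE/h; first by rewrite mem_cat as1.
move: hs; rewrite pairwise_cat => /and3P[/allrelP hs _ _].
by apply: hs => //; exact: mem_head.
Qed.

Lemma head_comprehension (A B : eqType) (s : seq A) (X : A -> seq B) u c :
  flatten [seq X a | a <- s] = u :: c ->
  exists s1 a s2, [/\ s = s1 ++ a :: s2, u \in X a & {in s1, forall b, X b = [::]}].
Proof.
elim: s => //= a s IH; case eX: (X a) => [|u' c'] /=.
  case/IH => s1 [b [s2 [-> hu h]]]; exists (a :: s1), b, s2; split=> // d.
  by rewrite in_cons => /orP[/eqP->|/h].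
by case=> e _; exists [::], a, s; rewrite eX -e mem_head.
Qed.

Section Dfs.
Variables (k : nat) (w : seq layer) (g : seq node) (T : seq nat).
Hypothesis k_gt0 : 0 < k.
Hypothesis g_drawing : drawing k [:: 0] w g T.
Hypothesis g_uniq : uniq (0 :: flatten (map outs g)).
Let F := planar_order [:: 0] g.
Let g_df : depth_first g T F := depth_first_graph k_gt0 g_drawing g_uniq.

Lemma mem_planar_order_graph : F =i 0 :: flatten (map outs g).
Proof.
move=> e; apply/idP/idP; first exact: mem_planar_order.
rewrite in_cons => /orP[/eqP->|/flatten_mapP[x xg ex]].
  by rewrite /F; have [O' ->] := planar_order_cons 0 [::] g; exact: mem_head.
by apply: (df_mem g_df xg); rewrite mem_cat ex orbT.
Qed.

Lemma size_planar_order_graph : size F = (size (flatten (map outs g))).+1.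
Proof.
rewrite -[RHS]/(size (0 :: flatten (map outs g))); apply: perm_size.
by apply: uniq_perm => //; [exact: df_uniq g_df | exact: mem_planar_order_graph].
Qed.

Lemma dfs_step_order t : t < size (flatten (map outs g)) ->
  dfs_step g (take t.+1 F) = take t.+2 F.
Proof.
move=> ht; set L := take t.+1 F; have hF : t.+1 < size F by rewrite size_planar_order_graph.
have uF : uniq F := df_uniq g_df.
pose e := nth 0 F t.+1; have eF : e \in F by exact: mem_nth.
have ie : index e F = t.+1 by exact: index_uniq.
have memL a : a \in F -> (a \in L) = (index a F < t.+1) by move=> aF; rewrite in_take.
have [v vg ev] : exists2 v, v \in g & e \in outs v.
  apply/flatten_mapP; move: eF; rewrite mem_planar_order_graph in_cons => /orP[/eqP e0|//].
  by move: ie; rewrite e0 /F; have [O' ->] := planar_order_cons 0 [::] g.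
have dF x d : x \in g -> d \in outs x -> d \in F.
  by move=> xg dx; apply: (df_mem g_df xg); rewrite mem_cat dx orbT.
have iF x d : x \in g -> d \in ins x -> d \in F.
  by move=> xg dx; apply: (df_mem g_df xg); rewrite mem_cat dx.
have lv : index (last 0 (ins v)) F < t.+1.
  have := earlier_head (df_outs g_df vg) ev; rewrite (df_next g_df vg) ie; exact.
have eL : e \notin L by rewrite memL // ie ltnn.
have av : v \in active g L.
  rewrite mem_filter vg andbT; apply/andP; split; last by apply/hasP; exists e.
  apply/allP => a av /=; rewrite memL ?(iF v) //.
  by apply: leq_ltn_trans lv; exact: earlier_last (df_ins g_df vg) av.
have lv_ins : last 0 (ins v) \in ins v by apply: last_mem; have [] := df_nil g_df vg.
rewrite /dfs_step.
have : v \in [seq x | a <- rev L, x <- [seq x <- active g L | a \in ins x]].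
  apply/allpairsPdep; exists (last 0 (ins v)), v; split=> //.
    by rewrite mem_rev memL // (iF v).
  by rewrite mem_filter lv_ins.
case hc: [seq x | a <- rev L, x <- [seq x <- active g L | a \in ins x]] => [//|u c] _.
suff -> : u = v.
  rewrite (head_filter_pairwise (O := F) (e := e)) //.
  - by rewrite (take_nth 0 hF).
  - exact: df_outs g_df v vg.
  - move=> a av' ae; rewrite negbK memL ?(dF v) //; by move: ae; rewrite /earlier ie.
case: (head_comprehension hc) => s1 [a [s2 [eL2 hu hs1]]].
move: hu; rewrite map_id mem_filter => /andP[au]; rewrite mem_filter.
case/andP=> /andP[/allP uL /hasP[d du dL]] ug.
apply/eqP/negPn/negP => uv.
have lu_ins : last 0 (ins u) \in ins u by apply: last_mem; have [] := df_nil g_df ug.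
have uins : uniq (flatten (map ins g)).
  have := perm_uniq (drawing_perm g_drawing); rewrite g_uniq => /esym.
  by rewrite cat_uniq => /andP[].
have luv : last 0 (ins u) != last 0 (ins v).
  apply: contra uv => /eqP e1; apply/eqP/(flatten_map_inj uins ug vg lu_ins).
  by rewrite e1.
have le_v : index (last 0 (ins v)) F <= index a F.
  have uL' : uniq (rev L) by rewrite rev_uniq take_uniq.
  have := uL'; rewrite eL2 => uL2.
  have lvL : last 0 (ins v) \in L by rewrite memL // (iF v).
  have lvs : last 0 (ins v) \notin s1.
    apply/negP => /hs1; rewrite map_id => e0.
    have : v \in [::] by rewrite -e0 mem_filter lv_ins.
    by [].
  have eL3 : L = rev s2 ++ a :: rev s1.
    by rewrite -[L]revK eL2 rev_cat rev_cons cat_rcons.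
  have aL : a \in L by rewrite eL3 mem_cat mem_head orbT.
  have iL b : b \in L -> index b F = index b L.
    by move=> bL; rewrite -{1}(cat_take_drop t.+1 F) index_cat -/L bL.
  rewrite !iL // eL3; move: lvL; rewrite eL3 !index_cat /= eqxx addn0.
  have -> : (a \in rev s2) = false.
    move: uL2; rewrite cat_uniq /= mem_rev => /and4P[_ _ h _]; exact/negbTE.
  rewrite mem_cat in_cons !mem_rev (negPf lvs) orbF.
  case: (boolP (_ \in s2)) => [h _|_ /= /eqP->]; last by rewrite eqxx addn0.
  by rewrite ltnW // index_mem mem_rev.
have le_u : index a F <= index (last 0 (ins u)) F.
  exact: earlier_last (df_ins g_df ug) au.
apply: (df_nested g_df ug vg ev du).
- rewrite /earlier ltn_neqAle (leq_trans le_v le_u) andbT.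
  apply: contra luv => /eqP e1; apply/eqP/esym.
  by rewrite -(nth_index 0 (iF v _ vg lv_ins)) e1 nth_index // (iF u).
- rewrite /earlier ie; have := uL _ lu_ins; rewrite /= memL //; exact: iF ug lu_ins.
- have : d != e.
    apply: contra uv => /eqP de; apply/eqP.
    have uouts : uniq (flatten (map outs g)) by case/andP: g_uniq.
    by apply: (flatten_map_inj uouts ug vg du); rewrite de.
  move: dL; rewrite /= memL ?(dF u) // -leqNgt /earlier ie leq_eqVlt => /orP[/eqP h|//].
  by case/negP; rewrite -(nth_index 0 (dF u _ ug du)) -h.
Qed.

Lemma dfs_order t : t <= size (flatten (map outs g)) -> Defs.dfs t g = take t.+1 F.
Proof.
elim: t => [|t IH] ht; last by rewrite /= IH ?dfs_step_order // ltnW.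
by rewrite /F; have [O' ->] := planar_order_cons 0 [::] g; rewrite /= take0.
Qed.

End Dfs.

Lemma index_rev_uniq (T : eqType) (s : seq T) a : uniq s -> a \in s ->
  index a (rev s) = size s - (index a s).+1.
Proof.
move=> us sa; case/splitPr: s / sa us => s1 s2; rewrite cat_uniq /= negb_or.
case/and4P=> _ /andP[as1 _] as2 _; rewrite rev_cat rev_cons cat_rcons.
rewrite !index_cat mem_rev (negPf as1) (negPf as2) /= eqxx !addn0 size_cat size_rev /=.
by rewrite addnS subSS addKn.
Qed.

Lemma take_drop_rev (T : Type) (s : seq T) d r : d + r <= size s ->
  take r (drop d (rev s)) = rev (take r (drop (size s - d - r) s)).
Proof.
move=> h; rewrite drop_rev take_rev size_takel ?leq_subr // take_drop subnKC //.
lia.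
Qed.

Definition heads (o : operator) (g : seq node) : seq nat :=
  [seq head 0 (outs x) | x <- g & op_of x == o].

Lemma row_edges2 k m g : well_formed k m g -> row_edges g 2 = heads Product g.
Proof.
case=> _ _ hs _; rewrite /row_edges /heads; elim: g hs => //= x g IH hs.
have {}IH := IH (fun y hy => hs y (mem_behead (s := x :: g) hy)).
have [_] := hs x (mem_head _ _); case: (op_of x) => //=.
by rewrite IH; case: (outs x) => [|e []].
Qed.

Lemma row_labels_heads k m g (b : bool) : well_formed k m g ->
  row_labels m g b.*2 =
  sort leq [seq index e (Defs.dfs m g) | e <- heads (if b then Product else Coproduct) g].
Proof. by move=> hg; case: b => //; rewrite /row_labels (row_edges2 hg). Qed.

Definition label_compl (m a : nat) : nat := m.+1 - a.

Lemma label_complK m a : a <= m.+1 -> label_compl m (label_compl m a) = a.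
Proof. exact: subKn. Qed.

Lemma perm_label_compl m : perm_eq (map (label_compl m) (iota 1 m)) (iota 1 m).
Proof.
apply: uniq_perm; rewrite ?iota_uniq //.
  rewrite map_inj_in_uniq ?iota_uniq // => a b; rewrite !mem_iota /label_compl.
  by lia.
move=> a; rewrite mem_iota; apply/mapP/idP => [[b]|ha].
  by rewrite mem_iota /label_compl => hb ->; lia.
by exists (label_compl m a); rewrite ?mem_iota /label_compl; lia.
Qed.

Section Rotation.
Variables (k n : nat) (w : seq layer).
Hypotheses (k_gt0 : 0 < k) (w_closed : closed_word k n w).
Let m := k.+1 * n.
Let w' := rotate_layers w.
Let w'_closed : closed_word k n w' := closed_word_rotate w_closed.

Lemma graph_drawing v : closed_word k n v ->
  exists e, drawing k [:: 0] v (graph k v) [:: e].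
Proof.
case/and3P=> hv _ _.
have [T hT] := @drawing_graph_from k [:: 0] 1 v 1 hv.
by case: T hT => [|e []] // hT _; exists e.
Qed.

Lemma dfs_graph v : closed_word k n v ->
  Defs.dfs m (graph k v) = planar_order [:: 0] (graph k v).
Proof.
move=> hv; have [e hd] := graph_drawing hv.
have [hout _ _ _] := graph_well_formed hv.
have u : uniq (0 :: flatten (map outs (graph k v))) by rewrite hout (iota_uniq 0 m.+1).
have sz : size (flatten (map outs (graph k v))) = m by rewrite hout size_iota.
rewrite (dfs_order k_gt0 hd u) ?sz // take_oversize //.
by rewrite (size_planar_order_graph k_gt0 hd u) sz.
Qed.

Lemma dfs_rotate : exists s : nat -> nat, [/\ injective s,
  graph k w' = map (rename s) (rev (map flip (graph k w))) &
  Defs.dfs m (graph k w') = map s (rev (Defs.dfs m (graph k w)))].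
Proof.
have [e hd] := graph_drawing w_closed; have [e' hd'] := graph_drawing w'_closed.
have [hout _ _ _] := graph_well_formed w_closed.
have [hout' _ _ _] := graph_well_formed w'_closed.
have u : uniq (0 :: flatten (map outs (graph k w))) by rewrite hout (iota_uniq 0 m.+1).
have u' : uniq (0 :: flatten (map outs (graph k w'))) by rewrite hout' (iota_uniq 0 m.+1).
set h := rev (map flip (graph k w)).
have hdh : drawing k [:: e] w' h [:: 0] := drawing_flip hd.
have hp : perm_eq (e :: flatten (map outs h)) (0 :: flatten (map outs (graph k w))).
  rewrite perm_sym; apply: perm_trans (drawing_perm hd) _.
  rewrite perm_catC perm_cons perm_sym /h map_rev -map_comp.
  elim: (graph k w) => //= x g IH.
  rewrite rev_cons -cats1 flatten_cat /= cats0 perm_catC.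
  by apply: perm_cat => //; rewrite perm_rev.
have sz : size (e :: flatten (map outs h)) = size (0 :: flatten (map outs (graph k w'))).
  by rewrite (perm_size hp) /= hout hout'.
have [s sI [se hs]] := injective_extension (etrans (perm_uniq hp) u) u' sz.
have eg : graph k w' = map (rename s) h.
  by apply: (drawing_rename hdh hd') => //=; rewrite se.
exists s; split=> //.
rewrite !dfs_graph // eg -[[:: 0]]/([:: 0]) -{1}se -[[:: s e]]/(map s [:: e]).
rewrite planar_order_map // => [|x xh]; last first.
  by have [] := drawing_nonempty k_gt0 hdh xh.
congr map; rewrite (planar_order_coorder k_gt0 hd) // rev_planar_coorder //.
Qed.

Lemma heads_rotate o :
  perm_eq [seq index e (Defs.dfs m (graph k w')) | e <- heads o (graph k w')]
    [seq label_compl m (index e (Defs.dfs m (graph k w))) | e <- heads (dual o) (graph k w)].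
Proof.
have [s [sI -> ->]] := dfs_rotate.
have [e hd] := graph_drawing w_closed; have [hout _ _ _] := graph_well_formed w_closed.
have u : uniq (0 :: flatten (map outs (graph k w))) by rewrite hout (iota_uniq 0 m.+1).
have hf := depth_first_graph k_gt0 hd u.
rewrite /heads -!map_comp filter_map -map_comp filter_rev map_rev perm_rev.
rewrite filter_map -map_comp.
rewrite (eq_filter (a2 := fun x => op_of x == dual o)); last first.
  by move=> x /=; case: o; rewrite /flip /rename /op_of /=; case: x.1.1.
apply/permP => P; congr count; apply/eq_in_map => x; rewrite mem_filter => /andP[_ xg] /=.
have [nI nO] := df_nil hf xg.
rewrite /rename /flip /outs /= map_rev head_rev.
rewrite (_ : last 0 _ = s (last 0 (ins x))); last first.
  by case: (ins x) nI => //= a I _; rewrite last_map.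
rewrite index_map // dfs_graph // index_rev_uniq ?(df_uniq hf) //; last first.
  by apply: (df_mem hf xg); rewrite mem_cat last_mem.
rewrite (size_planar_order_graph k_gt0 hd u) hout size_iota subSS (df_next hf xg).
by rewrite /label_compl subSS.
Qed.

Lemma perm_row_labels_rotate i : i < 3 ->
  perm_eq (row_labels m (graph k w') i)
          (map (label_compl m) (row_labels m (graph k w) (2 - i))).
Proof.
have hg := graph_well_formed w_closed; have hg' := graph_well_formed w'_closed.
have outer (b : bool) : perm_eq (row_labels m (graph k w') b.*2)
    (map (label_compl m) (row_labels m (graph k w) (2 - b.*2))).
  rewrite (_ : 2 - b.*2 = (~~ b).*2); last by case: b.
  rewrite !(row_labels_heads _ hg) !(row_labels_heads _ hg') perm_sort.
  apply: perm_trans (heads_rotate _) _; rewrite map_comp.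
  by rewrite perm_sym; apply: perm_map; rewrite perm_sort; case: b.
case: i => [|[|[|]]] // _; [exact: (outer false) | | exact: (outer true)].
have /permP h3 := perm_trans (perm_map (label_compl m) (perm_row_labels k_gt0 hg))
  (perm_label_compl m).
have /permP h3' := perm_row_labels k_gt0 hg'.
have /permP h4 := outer false; have /permP h5 := outer true.
apply/permP => P; move: (h3' P) (h3 P) (h4 P) (h5 P).
rewrite !map_cat !count_cat /= -/m => <- e3 e4 e5; move: e3; rewrite e4 e5.
have cancel a b c d : a + (b + c) = c + (d + a) -> d = b by clear; lia.
exact: cancel.
Qed.

Lemma row_labels_rotate i : i < 3 ->
  row_labels m (graph k w') i =
  rev (map (label_compl m) (row_labels m (graph k w) (2 - i))).
Proof.
move=> hi; have hg := graph_well_formed w_closed; have hg' := graph_well_formed w'_closed.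
apply: (sorted_eq leq_trans anti_leq); last first.
- by rewrite perm_sym perm_rev perm_sym; exact: perm_row_labels_rotate.
- rewrite rev_sorted; apply: homo_sorted (sort_sorted leq_total _).
  by move=> a b h; rewrite leq_sub2l.
- exact: sort_sorted leq_total _.
Qed.

Lemma Phi_filling_rotate :
  Phi_filling k n w' = schutz_filling (Phi_filling k n w).
Proof.
apply/ffunP => -[i j]; rewrite [LHS]ffunE [RHS]ffunE /=; apply/setP => a.
have -> : (a \in [set rev_ord b | b in Phi_filling k n w (rev_ord i, rev_ord j)]) =
    (rev_ord a \in Phi_filling k n w (rev_ord i, rev_ord j)).
  apply/imsetP/idP => [[b hb ->]|h]; first by rewrite rev_ordK.
  by exists (rev_ord a); rewrite ?rev_ordK.
rewrite ffunE !inE /= rho_rev row_labels_rotate //.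
have -> : 3 - i.+1 = 2 - i by [].
set R := row_labels m (graph k w) (2 - i).
have szR : size R = n * rho k i.
  by have := size_row_labels (rev_ord i) k_gt0 w_closed; rewrite rho_rev.
have hle : j * rho k i + rho k i <= n * rho k i.
  by rewrite -mulSnr leq_mul2r ltn_ord orbT.
rewrite take_drop_rev size_map szR // mem_rev -map_drop -map_take.
have -> : n * rho k i - j * rho k i - rho k i = (n - j.+1) * rho k i.
  by rewrite mulnBl mulSnr subnDA.
have hR b : b \in R -> b <= m.
  have := perm_mem (perm_row_labels k_gt0 (graph_well_formed w_closed)) b.
  rewrite !mem_cat mem_iota => h bR; have : 1 <= b < 1 + m; last by lia.
  rewrite -h; move: bR; rewrite /R.
  by case: (i) => [[|[|[|]]]] //= _ ->; rewrite ?orbT.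
have lt_a : a < m := ltn_ord a.
have -> : (m - a.+1).+1 = label_compl m a.+1 by rewrite subnSK // /label_compl subSS.
apply/mapP/idP => [[b hb ->]|h]; last first.
  by exists (label_compl m a.+1) => //; rewrite label_complK // leqW.
by rewrite label_complK //; apply: leqW; exact: hR (mem_drop (mem_take hb)).
Qed.

End Rotation.

Theorem theorem4p5 (k n : nat) (hk : 2 <= k) (hn : 1 <= n) :
  @Phi k n hk \o @rotate k n =1 @schutzenberger k n \o @Phi k n hk.
Proof.
move=> G /=; rewrite -(reprK G) -rotate_pi !Phi_pi; apply: val_inj => /=.
by apply: Phi_filling_rotate; [exact: ltnW | exact: valP].
Qed.
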